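(* For every integer $k\ge 1$ there is $\delta_k>0$ such that the following holds. Let $G$ be a connected $\mathcal{O}_k$-free graph of girth at least 11 which contains a cycle, let $C$ be a shortest cycle of $G$, let $N$ be the set of vertices not in $V(C)$ having a neighbor in $V(C)$, and let $R=V(G)\setminus(V(C)\cup N)$. If $G[R]$ is a forest, then $G$ has a vertex $x$ with $\deg_G(x)\ge \delta_k\cdot r(G)$.
   Context: All graphs are finite and simple. The cycle rank of $G$ is $r(G)=|E(G)|-|V(G)|+|\mathcal{C}(G)|$, where $\mathcal{C}(G)$ is the set of connected components of $G$. Two vertex-disjoint subgraphs are independent if there is no edge between them. A graph $G$ is $\mathcal{O}_k$-free if it does not contain $k$ pairwise vertex-disjoint and pairwise independent cycles; equivalently, $G$ has no induced subgraph isomorphic to a disjoint union of $k$ cycles. The girth is the minimum length of a cycle. *)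

(* Defs.v *)
From mathcomp Require Import all_boot all_order all_algebra.
From mathcomp Require Import reals.
Set Implicit Arguments. Unset Strict Implicit. Unset Printing Implicit Defensive.
Import Order.TTheory GRing.Theory Num.Theory.

Definition simple_graph (T : finType) (e : rel T) : Prop :=
  symmetric e /\ irreflexive e.

Definition is_cycle (T : finType) (e : rel T) (c : seq T) : Prop :=
  [/\ 3 <= size c, uniq c & cycle e c].

Definition connected_graph (T : finType) (e : rel T) : Prop :=
  forall x y : T, connect e x y.

Definition has_cycle (T : finType) (e : rel T) : Prop :=
  exists c, is_cycle e c.

Definition girth_ge (T : finType) (e : rel T) (g : nat) : Prop :=
  forall c, is_cycle e c -> g <= size c.

Definition shortest_cycle (T : finType) (e : rel T) (c : seq T) : Prop :=
  is_cycle e c /\ forall c', is_cycle e c' -> size c <= size c'.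

Definition Ok_free (T : finType) (e : rel T) (k : nat) : Prop :=
  ~ exists f : 'I_k -> seq T,
      (forall i, is_cycle e (f i)) /\
      (forall i j, i != j -> forall x y, x \in f i -> y \in f j ->
         x != y /\ ~~ e x y).

Definition induced_forest (T : finType) (e : rel T) (S : {set T}) : Prop :=
  ~ exists c, is_cycle e c /\ all (fun x => x \in S) c.

Definition deg (T : finType) (e : rel T) (x : T) : nat := #|[set y | e x y]|.

Definition n_edges (T : finType) (e : rel T) : nat :=
  #|[set A : {set T} | [exists x, [exists y, e x y && (A == [set x; y])]]]|.

Definition n_components (T : finType) (e : rel T) : nat :=
  #|[set fingraph.root e x | x : T]|.

Definition cycle_rank (T : finType) (e : rel T) : int :=
  (n_edges e)%:Z - (#|T|)%:Z + (n_components e)%:Z.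

Definition nbhd_out (T : finType) (e : rel T) (c : seq T) : {set T} :=
  [set v | (v \notin c) && [exists u, (u \in c) && e v u]].

Definition rest (T : finType) (e : rel T) (c : seq T) : {set T} :=
  [set v | (v \notin c) && (v \notin nbhd_out e c)].

(* Main.v *)
(* Let S be the set of vertices of R with a neighbour in N. Since the girth is at least 11, short
   ears on C are excluded: N and S are independent and each vertex of S has one foot in N. Hence
   the cycle rank is |S| + |E(R)| - |R| + 1 at most, and it remains to bound this by a multiple of
   the maximum degree D. Stripping leaves decomposes the forest G[R] into spiders whose legs end
   in S, with a linear number of surplus legs; after 2-colouring, the spiders are pairwise
   independent. A random choice of feet makes the centres in S harmless. The cycle C is cut into
   blocks to which O_k(D) legs attach, and the legs become the edges of a bipartite multigraph
   between spiders and blocks. If the surplus is large compared with D, then this multigraph is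
   dense enough to contain k disjoint subgraphs with as many edges as vertices, and these pull
   back to k independent cycles. *)
Require Import Defs.
From mathcomp Require Import all_boot all_order all_algebra.
From mathcomp Require Import reals zify.
Set Implicit Arguments. Unset Strict Implicit. Unset Printing Implicit Defensive.

(** * Dense graphs *)

(** No cycle is carried through the construction. All of it is stated for vertex sets with at least
    as many edges as vertices ([rich]), because the edge counts of spiders, feet and segments of the
    cycle simply add up; a cycle is extracted from each set only at the very end. What the
    successive selections preserve, up to constant factors and O(kD), is the surplus of legs over
    spiders. The obstacle is linearity in D. Neighbouring blocks of C are adjacent, so a vertex
    between them has to be given up; yet up to D feet and D^2 legs may depend on that vertex, too
    many to discard at every cut. Each such foot therefore becomes a vertex of the multigraph in its
    own right. With a cut about every 24kD legs, this creates about D vertices per 24kD legs. The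
    density bound charges 3k for each of them, in total a small fraction of the legs, while every
    spider that is kept has two legs or more and so at least half of the legs are surplus. *)

Section Arcs.
Variables (T : finType) (e : rel T).
Implicit Types (U V X Y Z : {set T}) (x y : T).

Definition cross X Y : nat := \sum_(x in X) \sum_(y in Y) e x y.
(* Twice the number of edges that [X] spans. *)
Definition arcs X : nat := cross X X.
Definition indep X Y : Prop := forall x y, x \in X -> y \in Y -> x != y /\ ~~ e x y.

Lemma cross0l Y : cross set0 Y = 0.
Proof. by rewrite /cross big_set0. Qed.

Lemma crossUl X Y Z : [disjoint X & Y] -> cross (X :|: Y) Z = cross X Z + cross Y Z.
Proof.
move=> d; rewrite /cross -bigU //; apply: eq_bigl => x.
by rewrite !inE.
Qed.

Lemma cross1l x Y : cross [set x] Y = #|[set y in Y | e x y]|.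
Proof.
rewrite /cross big_set1 -sum1_card big_mkcond [RHS]big_mkcond /=.
by apply: eq_bigr => y _; rewrite inE; case: (y \in Y); case: (e x y).
Qed.

Lemma cross_le X X' Y Y' : X \subset X' -> Y \subset Y' -> cross X Y <= cross X' Y'.
Proof.
move=> sX sY; rewrite /cross big_mkcond [leqRHS]big_mkcond /=.
apply: leq_sum => x _; case: ifP => // /(subsetP sX) ->.
rewrite big_mkcond [leqRHS]big_mkcond /=.
by apply: leq_sum => y _; case: ifP => // /(subsetP sY) ->.
Qed.

Lemma cross_eq0 X Y : (forall x y, x \in X -> y \in Y -> ~~ e x y) -> cross X Y = 0.
Proof.
move=> h; rewrite /cross big1 // => x xX; rewrite big1 // => y yY.
by rewrite (negbTE (h _ _ xX yY)).
Qed.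

Lemma cross_gt0 X Y x y : x \in X -> y \in Y -> e x y -> 0 < cross X Y.
Proof.
move=> xX yY exy; rewrite /cross (bigD1 x) //= (bigD1 y) //= exy; lia.
Qed.

Lemma cross_leM X Y d : (forall x, x \in X -> cross [set x] Y <= d) -> cross X Y <= d * #|X|.
Proof.
move=> h; rewrite /cross mulnC -sum_nat_const; apply: leq_sum => x /h.
by rewrite /cross big_set1.
Qed.

Lemma cross_geM X Y d : (forall x, x \in X -> d <= cross [set x] Y) -> d * #|X| <= cross X Y.
Proof.
move=> h; rewrite /cross mulnC -sum_nat_const; apply: leq_sum => x /h.
by rewrite /cross big_set1.
Qed.

Hypothesis e_sym : symmetric e.

Lemma crossC X Y : cross X Y = cross Y X.
Proof.
rewrite /cross exchange_big /=; apply: eq_bigr => x _.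
by apply: eq_bigr => y _; rewrite e_sym.
Qed.

Lemma crossUr X Y Z : [disjoint X & Y] -> cross Z (X :|: Y) = cross Z X + cross Z Y.
Proof. by move=> d; rewrite !(crossC Z) crossUl. Qed.

Lemma arcsU X Y : [disjoint X & Y] -> arcs (X :|: Y) = arcs X + 2 * cross X Y + arcs Y.
Proof.
move=> d; rewrite /arcs crossUl // !crossUr // (crossC Y X); lia.
Qed.

Hypothesis e_irr : irreflexive e.

Lemma arcs1 x : arcs [set x] = 0.
Proof. by rewrite /arcs cross_eq0 // => a b /set1P -> /set1P ->; rewrite e_irr. Qed.

Lemma arcsD1 x X : x \in X -> arcs X = arcs (X :\ x) + 2 * cross [set x] (X :\ x).
Proof.
move=> xX; rewrite -{1}(setD1K xX) arcsU ?arcs1; first lia.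
by rewrite disjoints1 !inE eqxx.
Qed.

Lemma cross1D1 x X : cross [set x] (X :\ x) = cross [set x] X.
Proof.
rewrite !cross1l; apply: eq_card => y; rewrite !inE.
by case: (eqVneq y x) => //= ->; rewrite e_irr andbF.
Qed.

Lemma arcsU1 x X : x \notin X -> arcs (x |: X) = arcs X + 2 * cross [set x] X.
Proof. by move=> xX; rewrite arcsU ?disjoints1 // arcs1; lia. Qed.

(* Counting the pairs (x, par x) and (par x, x); the rank keeps the two families apart. *)
Lemma arcs_parent X Y (par : T -> T) (rk : T -> nat) : Y \subset X ->
  (forall x, x \in Y -> [/\ par x \in X, e x (par x) & rk x < rk (par x)]) ->
  2 * #|Y| <= arcs X.
Proof.
move=> YX hp; rewrite /arcs /cross.
have -> : 2 * #|Y| = \sum_(x in X) \sum_(y in X) ((x \in Y) && (y == par x) : nat)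
   + \sum_(x in X) \sum_(y in X) ((y \in Y) && (x == par y) : nat).
  rewrite [X in _ + X]exchange_big /=.
  have h : \sum_(x in X) \sum_(y in X) ((x \in Y) && (y == par x) : nat) = #|Y|.
    transitivity (\sum_(x in X) (x \in Y : nat)).
      apply: eq_bigr => x xX; case: (boolP (x \in Y)) => xY /=; last by rewrite big1.
      have [pX _ _] := hp _ xY.
      rewrite (bigD1 (par x)) //= eqxx big1 // => y /andP [_ /negbTE ->] //.
    rewrite -sum1_card big_mkcond [RHS]big_mkcond /=; apply: eq_bigr => x _.
    by case: (boolP (x \in Y)) => [/(subsetP YX) ->|_] //; case: (x \in X).
  by rewrite h; lia.
rewrite -big_split /=; apply: leq_sum => x _.
rewrite -big_split /=; apply: leq_sum => y _.
case: (boolP (x \in Y)) => xY; case: (boolP (y \in Y)) => yY /=; last 1 first.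
- by [].
- have [_ exy r1] := hp _ xY; have [_ eyx r2] := hp _ yY.
  case: eqVneq => [E|_] /=; case: eqVneq => [E'|_] /=; rewrite ?addn0 //.
  + by exfalso; move: r1 r2; rewrite -E -E'; lia.
  + by rewrite E exy.
  + by rewrite E' e_sym eyx.
- have [_ exy r1] := hp _ xY; rewrite addn0.
  by case: eqVneq => [->|] //; rewrite exy.
- have [_ exy r1] := hp _ yY; rewrite add0n.
  by case: eqVneq => [->|] //; rewrite e_sym exy.
Qed.

Lemma arcs_even X : ~~ odd (arcs X).
Proof.
have [n] := ubnP #|X|; elim: n X => // n IH X lt.
have [->|[x xX]] := set_0Vmem X; first by rewrite /arcs cross0l.
rewrite (arcsD1 xX) oddD oddM /= addbF; apply: IH.
by have := cardsD1 x X; rewrite xX; lia.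
Qed.

Definition rich U := (U != set0) && (2 * #|U| <= arcs U).


Lemma minimal_rich_sub X : rich X ->
  exists2 U : {set T}, U \subset X & [/\ rich U & forall V, V \subset X -> rich V -> #|U| <= #|V|].
Proof.
move=> rX.
pose P U := (U \subset X) && rich U.
have h : P X by rewrite /P subxx.
case: (arg_minnP (fun U : {set T} => #|U|) h) => U /andP [UX rU] m.
by exists U => //; split=> // V VX rV; apply: m; rewrite /P VX.
Qed.

(** Removing [x] must destroy richness, and [arcs] is even, so [arcs (U :\ x) <= 2 * #|U| - 4].
    Hence every degree is at least [2 + t / 2], where [t] is the excess of [arcs U] over [2 * #|U|].
    Summation forces [t = 0], and then all degrees equal their average 2. *)
Lemma minimal_rich_degree X U : U \subset X -> rich U ->
  (forall V, V \subset X -> rich V -> #|U| <= #|V|) ->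
  arcs U = 2 * #|U| /\ forall x, x \in U -> cross [set x] U = 2.
Proof.
move=> UX /andP [U0 rU] m.
have cU : 2 < #|U|.
  have V0 : 0 < #|U| by rewrite card_gt0.
  have : arcs U <= #|U|.-1 * #|U|.
    apply: cross_leM => x xU; rewrite -cross1D1 cross1l.
    apply: leq_trans (subset_leq_card (_ : _ \subset U :\ x)) _.
      by apply/subsetP => y; rewrite inE => /andP [].
    by have := cardsD1 x U; rewrite xU; lia.
  nia.
have hdeg x : x \in U -> arcs U + 4 <= 2 * #|U| + 2 * cross [set x] U.
  move=> xU; rewrite leqNgt; apply/negP => h.
  have cD := cardsD1 x U; rewrite xU in cD.
  have := m (U :\ x) (subset_trans (subsetDl _ _) UX).
  have aD := arcsD1 xU; rewrite cross1D1 in aD.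
  rewrite /rich -card_gt0.
  have -> : (0 < #|U :\ x|) && (2 * #|U :\ x| <= arcs (U :\ x)) by
    have p := arcs_even U; apply/andP; lia.
  by move=> /(_ isT); lia.
have aE : arcs U = 2 * #|U|.
  have h2 : (arcs U + 4 - 2 * #|U|) * #|U| <= 2 * arcs U.
    rewrite /arcs -[X in _ <= 2 * X]/(cross U U).
    have -> : 2 * cross U U = \sum_(x in U) 2 * cross [set x] U.
      by rewrite -big_distrr /= /cross; congr (_ * _); apply: eq_bigr => x _; rewrite big_set1.
    rewrite mulnC -sum_nat_const; apply: leq_sum => x /hdeg; rewrite /arcs; lia.
  (* In terms of [t] the summed bound is [(t + 4) * #|U| <= 2 * (2 * #|U| + t)], that is
     [t * #|U| <= 2 * t]; as [#|U|] is at least 3, [t] vanishes. *)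
  have [t E] : exists t, arcs U = 2 * #|U| + t by exists (arcs U - 2 * #|U|); lia.
  move: h2; rewrite E (_ : 2 * #|U| + t + 4 - 2 * #|U| = t + 4) ?mulnDl; last lia.
  by have := leq_mul (leqnn t) cU; lia.
split=> // x xU; apply/eqP; rewrite eqn_leq; apply/andP; split; last by have := hdeg _ xU; lia.
have s : 2 * #|U :\ x| <= \sum_(y in U :\ x) cross [set y] U.
  by rewrite mulnC -sum_nat_const; apply: leq_sum => y /setD1P [_ yU]; have := hdeg _ yU; lia.
have E : arcs U = cross [set x] U + \sum_(y in U :\ x) cross [set y] U.
  rewrite /arcs -{1}(setD1K xU) crossUl ?disjoints1 ?inE ?eqxx //; congr (_ + _).
  by rewrite {1}/cross; apply: eq_bigr => y _; rewrite /cross big_set1.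
have cD := cardsD1 x U; rewrite xU in cD; lia.
Qed.

(* Otherwise adding [v] and removing two adjacent vertices, one of them a neighbour of [v], would
   give a smaller rich set. *)
Lemma minimal_rich_outside X U v : U \subset X -> rich U ->
  (forall V, V \subset X -> rich V -> #|U| <= #|V|) ->
  v \in X -> v \notin U -> cross [set v] U <= 3.
Proof.
move=> UX rU m vX vU; rewrite leqNgt; apply/negP => h4.
have [aE dE] := minimal_rich_degree UX rU m.
have : 0 < cross [set v] U by lia.
rewrite cross1l card_gt0 => /set0Pn [w]; rewrite inE => /andP [wU evw].
have : 0 < cross [set w] U by rewrite dE.
rewrite cross1l card_gt0 => /set0Pn [w']; rewrite inE => /andP [w'U eww].
have ww : w' != w by apply/eqP => E; rewrite E e_irr in eww.
have w'D : w' \in U :\ w by rewrite !inE ww.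
pose V := U :\ w :\ w'.
have vV : v \notin V by rewrite !inE (negbTE vU) !andbF.
have c1 := cardsD1 w U; rewrite wU in c1.
have c2 := cardsD1 w' (U :\ w); rewrite w'D in c2.
have a1 := arcsD1 wU; rewrite cross1D1 dE // in a1.
have a2 := arcsD1 w'D; rewrite cross1D1 in a2.
have d1 : cross [set w'] U = cross [set w'] [set w] + cross [set w'] (U :\ w).
  by rewrite -[in LHS](setD1K wU) crossUr // disjoints1 !inE eqxx.
have g1 : 0 < cross [set w'] [set w].
  by apply: (@cross_gt0 _ _ w' w); rewrite ?set11 // e_sym.
have d2 : cross [set v] U = cross [set v] [set w] + cross [set v] (U :\ w).
  by rewrite -[in LHS](setD1K wU) crossUr // disjoints1 !inE eqxx.
have d3 : cross [set v] (U :\ w) = cross [set v] [set w'] + cross [set v] V.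
  by rewrite -[in LHS](setD1K w'D) crossUr // disjoints1 !inE eqxx.
have le1 a b : cross [set a] [set b] <= 1 by rewrite /cross !big_set1; case: (e a b).
have l1 := le1 v w; have l2 := le1 v w'.
have cV : #|v |: V| = #|V|.+1 by rewrite cardsU1 vV.
have aV := arcsU1 vV.
have d4 := dE _ w'U.
have sV : v |: V \subset X.
  by rewrite subUset sub1set vX !(subset_trans (subsetDl _ _)).
have cU : #|U| = #|V|.+2 by rewrite c1 c2.
have : #|U| <= #|v |: V|.
  apply: m => //; rewrite /rich -card_gt0 cV aV /=.
  move: a1 a2; rewrite -/V aE cU.
  clear -d1 g1 d2 d3 l1 l2 d4 h4; lia.
by rewrite cV cU ltnn.
Qed.

(* Remove a minimal rich set: this costs at most three edges per remaining vertex. *)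
Lemma dense_rich_family k X : X != set0 -> 6 * k * #|X| <= arcs X ->
  exists U : 'I_k -> {set T},
    (forall i, U i \subset X /\ rich (U i)) /\
    (forall i j, i != j -> [disjoint U i & U j]).
Proof.
elim: k X => [|k IH] X X0 hX.
  by exists (fun=> set0); split=> [[]|[]].
have cX : 0 < #|X| by rewrite card_gt0.
have h6 : 6 * k * #|X| + 6 * #|X| <= arcs X.
  by apply: leq_trans hX; rewrite mulnS mulnDl; lia.
have rX : rich X by rewrite /rich X0; lia.
have [U UX [rU m]] := minimal_rich_sub rX.
have [aE dE] := minimal_rich_degree UX rU m.
have oE := minimal_rich_outside UX rU m.
case: (posnP k) => [k0|kp].
  subst k; exists (fun=> U); split=> // i j.
  by rewrite !ord1 eqxx.
have cD : #|X| = #|X :\: U| + #|U| by rewrite cardsDS //; have := subset_leq_card UX; lia.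
have aD : arcs X = arcs (X :\: U) + 2 * cross (X :\: U) U + arcs U.
  rewrite -arcsU ?setDUK //; last by rewrite disjoint_sym disjoints_subset setCD subsetUr.
  by rewrite setUC -{1}(setID X U) (setIidPr UX).
have cr : cross (X :\: U) U <= 3 * #|X :\: U|.
  by apply: cross_leM => x /setDP [xX xU]; apply: oE.
have [||V [hV dV]] := IH (X :\: U).
(* If nothing were left, [arcs X] would be only [2 * #|X|]. *)
- apply/eqP => Y0; move: h6 aD cD cX; rewrite Y0 cards0 /arcs !cross0l => h6' aD' cXU cX'.
  have h : 1 * #|X| <= k * #|X| by apply: leq_mul.
  by move: h6' h aE; rewrite -mulnA /arcs; lia.
- by move: h6; rewrite cD !mulnDr; lia.
exists (fun i => oapp V U (unlift ord0 i)); split.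
  move=> i; case: unliftP => [j _|_] /=; last by [].
  by have [s r] := hV j; split=> //; apply: subset_trans s (subsetDl _ _).
have dU j : [disjoint U & V j].
  rewrite disjoint_sym; have [s _] := hV j; apply: disjointWl s _.
  by rewrite disjoint_sym disjoints_subset setCD subsetUr.
move=> i j; case: unliftP => [i' ->|->]; case: unliftP => [j' ->|->] //=.
- by move=> ne; apply: dV; apply: contraNneq ne => ->.
- by move=> _; rewrite disjoint_sym.
Qed.

End Arcs.

(** * Bipartite multigraphs *)

Lemma sum_le1 (I : finType) (P : pred I) (f : I -> nat) :
  (forall i, P i -> f i <= 1) ->
  (forall i j, P i -> P j -> 0 < f i -> 0 < f j -> i = j) ->
  \sum_(i | P i) f i <= 1.
Proof.
move=> f1 fI; case: (pickP [pred i | P i & 0 < f i]) => [i /= /andP [Pi fi]|none].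
  rewrite (bigD1 i) //= big1 ?addn0 ?f1 // => j /andP [Pj ne].
  case: (posnP (f j)) => // fj; by rewrite (fI _ _ Pj Pi fj fi) eqxx in ne.
rewrite big1 // => i Pi; case: (posnP (f i)) => // fi.
by have := none i; rewrite /= Pi fi.
Qed.

Section Multigraph.
Variables (S Z W : finType) (z : S -> Z) (w : S -> W).
Implicit Types (J F : {set S}).

(* [S] is the edge set of a bipartite multigraph in which [s] joins [z s] to [w s]. *)
Definition cyclic F := (F != set0) && (#|z @: F| + #|w @: F| <= #|F|).

(** [cyclic] is the analogue of [rich] for sets of edges. Digons and quadrilaterals are [short], and
    they are the only obstacles to a simple quotient graph on [W]. *)
Definition short F := [&& cyclic F, #|z @: F| <= 2 & #|w @: F| <= 2].

Section NoShort.
Variable J : {set S}.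
Hypothesis noshort : forall F, F \subset J -> ~~ short F.

Definition rep s := odflt s [pick t in J | z t == z s].

Lemma repP s : s \in J -> rep s \in J /\ z (rep s) = z s.
Proof.
move=> sJ; rewrite /rep; case: pickP => [t /andP [tJ /eqP]|/(_ s)] //=.
Qed.

Lemma rep_eq s t : s \in J -> z s = z t -> rep s = rep t.
Proof.
move=> sJ E; rewrite /rep E; case: pickP => // /(_ s).
by rewrite sJ E eqxx.
Qed.

Lemma rep_idem s : s \in J -> rep (rep s) = rep s.
Proof. by move=> sJ; have [rJ E] := repP sJ; apply: rep_eq. Qed.

Lemma no_digon s t : s \in J -> t \in J -> z s = z t -> w s = w t -> s = t.
Proof.
move=> sJ tJ Ez Ew; apply/eqP/negP => /negP ne.
have sF : [set s; t] \subset J by rewrite subUset !sub1set sJ.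
have := noshort sF; rewrite /short /cyclic !imsetU1 !imset_set1 Ez Ew !setUid !cards1 cards2 ne.
by rewrite -card_gt0 cards2.
Qed.

(** One edge per star is spent as representative, so these are the edges counted by the surplus
    [#|J| - #|z @: J|]; each gives one edge of the quotient. *)
Definition nonrep := [set s in J | rep s != s].

Lemma nonrepP s : s \in nonrep -> [/\ s \in J, rep s \in J, z (rep s) = z s, rep s != s & w s != w (rep s)].
Proof.
rewrite inE => /andP [sJ ne]; have [rJ Ez] := repP sJ; split=> //.
by apply: contra ne => /eqP Ew; apply/eqP; apply: no_digon.
Qed.

Lemma no_quadrilateral s t : s \in nonrep -> t \in nonrep -> z s != z t ->
  [set w s; w (rep s)] = [set w t; w (rep t)] -> False.
Proof.
move=> /nonrepP [sJ rsJ zs ns ws] /nonrepP [tJ rtJ zt nt wt] zz Ew.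
pose A := [set s; rep s]; pose B := [set t; rep t].
have sF : A :|: B \subset J by rewrite !subUset !sub1set sJ rsJ tJ rtJ.
have zA : z @: A = [set z s] by rewrite imsetU1 imset_set1 zs setUid.
have zB : z @: B = [set z t] by rewrite imsetU1 imset_set1 zt setUid.
have wA : w @: A = [set w s; w (rep s)] by rewrite imsetU1 imset_set1.
have wB : w @: B = [set w s; w (rep s)] by rewrite imsetU1 imset_set1 Ew.
have d : [disjoint A & B].
  rewrite -setI_eq0; apply/eqP/setP => x; rewrite in_setI in_set0; apply/negP => /andP [xA xB].
  case/negP: zz; apply/eqP.
  have : z x \in z @: A by apply: imset_f.
  have : z x \in z @: B by apply: imset_f.
  by rewrite zA zB => /set1P -> /set1P ->.
have cA : #|A| = 2 by rewrite cards2 eq_sym ns.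
have cB : #|B| = 2 by rewrite cards2 eq_sym nt.
have cU : #|A :|: B| = 4 by have := cardsUI A B; rewrite (disjoint_setI0 d) cards0; lia.
have := noshort sF; rewrite /short /cyclic !(imsetU _ A B) zA zB wA wB setUid cards2 zz cards2 ws.
by rewrite -card_gt0 cU.
Qed.

(* Without digons and quadrilaterals, replacing the star of each vertex of [Z] by the edges that
   join the end of a representative to the other ends yields a simple graph on [W]. *)
Definition mult x y := \sum_(s in nonrep)
  (((x == w s) && (y == w (rep s))) + ((y == w s) && (x == w (rep s)))).

Definition quot x y := 0 < mult x y.

Lemma quot_sym : symmetric quot.
Proof. by move=> x y; congr (0 < _); apply: eq_bigr => s _; rewrite addnC. Qed.

Lemma quot_irr : irreflexive quot.
Proof.
move=> x; rewrite /quot /mult big1 // => s /nonrepP [_ _ _ _ ws].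
by case: eqVneq => [->|_] //=; rewrite (negbTE ws).
Qed.

(** Two edges that contribute to the same pair either lie in one star, where they end alike and form
    a digon, or in two stars, where together with the representatives they form a quadrilateral. *)
Lemma multE x y : mult x y = quot x y.
Proof.
suff : mult x y <= 1 by rewrite /quot; case: (mult x y) => [|[|]].
have key s : 0 < ((x == w s) && (y == w (rep s))) + ((y == w s) && (x == w (rep s))) ->
    [set w s; w (rep s)] = [set x; y].
  move=> h; have : ((x == w s) && (y == w (rep s))) || ((y == w s) && (x == w (rep s))).
    by move: h; do 2!case: (_ && _).
  by case/orP => /andP [/eqP -> /eqP ->] //; rewrite setUC.
apply: sum_le1 => [s sn|s t sn tn /key Es /key Et].
  have [_ _ _ _ ws] := nonrepP sn.
  case: (boolP (_ && _)) => [/andP [_ /eqP ->]|_]; last by case: (_ && _).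
  by rewrite [w (rep s) == w s]eq_sym (negbTE ws).
have Ew : [set w s; w (rep s)] = [set w t; w (rep t)] by rewrite Es Et.
have [/eqP zz|zz] := boolP (z s == z t); last by case: (no_quadrilateral sn tn zz Ew).
have [sJ _ zs ns ws] := nonrepP sn; have [tJ _ zt nt wt] := nonrepP tn.
have Er : rep s = rep t by apply: rep_eq.
apply: no_digon => //.
have : w s \in [set w t; w (rep t)] by rewrite -Ew set21.
by case/set2P => // E; rewrite E Er eqxx in ws.
Qed.

(** Edges whose representative ends outside [U] are left out. Thus every star that is met has its
    representative end in [U], so disjoint [U] have lifts without a common vertex in [Z]. *)
Definition lift_set (U : {set W}) := [set s in J | (w s \in U) && (w (rep s) \in U)].

Lemma arcs_quot (U : {set W}) : arcs quot U = 2 * #|nonrep :&: lift_set U|.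
Proof.
rewrite /arcs /cross; under eq_bigr => x _ do under eq_bigr => y _ do rewrite -multE /mult.
under eq_bigr => x _ do rewrite exchange_big /=.
rewrite exchange_big /=.
transitivity (\sum_(s in nonrep) 2 * (s \in lift_set U)); last first.
  rewrite -big_distrr /= -sum1_card; congr (_ * _); rewrite [LHS]big_mkcond [RHS]big_mkcond /=.
  by apply: eq_bigr => s _; rewrite in_setI; case: (s \in nonrep) => //=; case: (_ \in _).
apply: eq_bigr => s /nonrepP [sJ _ _ _ _]; rewrite inE sJ /=.
have half a b : \sum_(x in U) \sum_(y in U) ((x == a) && (y == b) : nat) = (a \in U) && (b \in U).
  transitivity (\sum_(x in U) ((x == a) && (b \in U) : nat)).
    apply: eq_bigr => x _; case: (x == a) => /=; last by rewrite big1.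
    case: (boolP (b \in U)) => bU; last by rewrite big1 // => y yU; case: eqVneq => // E; rewrite -E yU in bU.
    by rewrite (bigD1 b) //= eqxx big1 // => y /andP [_ /negbTE ->].
  case: (boolP (a \in U)) => aU /=; last first.
    by rewrite big1 // => x xU; case: eqVneq => // E; rewrite -E xU in aU.
  by rewrite (bigD1 a) //= eqxx big1 ?addn0 // => x /andP [_ /negbTE ->].
under eq_bigr => x _ do rewrite big_split /=.
rewrite big_split /= half [X in _ + X]exchange_big /= half; lia.
Qed.

Lemma card_nonrep : #|J| <= #|nonrep| + #|z @: J|.
Proof.
rewrite -(cardsID nonrep J).
have -> : J :&: nonrep = nonrep by apply/setIidPr/subsetP => s; rewrite inE => /andP [].
rewrite leq_add2l -(card_in_imset (f := z)) ?subset_leq_card ?imsetS ?subsetDl //.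
move=> s t /setDP [sJ sn] /setDP [tJ tn] E.
move: sn tn; rewrite !inE sJ tJ !negbK => /eqP <- /eqP <-; exact: rep_eq.
Qed.

(** The vertices in [W] number at most [#|U|], hence at most the edges in [nonrep]; the vertices in
    [Z] are matched with their representatives, which belong to the lift and are not in [nonrep]. *)
Lemma lift_set_cyclic (U : {set W}) : rich quot U -> cyclic (lift_set U).
Proof.
move=> /andP [U0 rU]; rewrite arcs_quot in rU.
have cU : 0 < #|U| by rewrite card_gt0.
have sw : #|w @: lift_set U| <= #|U|.
  by apply/subset_leq_card/subsetP => x /imsetP [s]; rewrite inE => /and3P [_ h _] ->.
have sz : #|z @: lift_set U| <= #|lift_set U :\: nonrep|.
  apply: leq_trans (leq_imset_card z _); apply/subset_leq_card/subsetP => a /imsetP [s].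
  rewrite inE => /and3P [sJ h1 h2] ->; have [rJ E] := repP sJ.
  by apply/imsetP; exists (rep s) => //; rewrite !inE rep_idem // rJ h2 eqxx.
have c := cardsID nonrep (lift_set U); rewrite setIC in c.
by rewrite /cyclic -card_gt0; apply/andP; split; lia.
Qed.

End NoShort.

(** A [short] set is taken out together with all edges at its at most four vertices, which costs
    [4 * D] per set. Once no [short] set is left, the simple quotient supplies all remaining sets at
    once; [3 * k] is half of the density [6 * k] because [arcs] counts edges twice. *)
Lemma cyclic_family k D J :
  (forall a, #|[set s in J | z s == a]| <= D) ->
  (forall b, #|[set s in J | w s == b]| <= D) ->
  #|z @: J| + 3 * k * #|w @: J| + 4 * k * D < #|J| ->
  exists F : 'I_k -> {set S},
    (forall i, F i \subset J /\ cyclic (F i)) /\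
    (forall i j, i != j -> forall s t, s \in F i -> t \in F j -> z s != z t /\ w s != w t).
Proof.
elim: k J => [|k IH] J hz hw hJ.
  by exists (fun=> set0); split=> [[]|[]].
case: (pickP [pred F : {set S} | (F \subset J) && short F]) => [C /= /andP [CJ]|none].
  move=> /and3P [cC z2 w2].
  pose J' := [set s in J | (z s \notin z @: C) && (w s \notin w @: C)].
  have sJ : J' \subset J by apply/subsetP => s; rewrite inE => /andP [].
  have fib (V : finType) (f : S -> V) (A : {set V}) : (forall a, #|[set s in J | f s == a]| <= D) ->
      #|[set s in J | f s \in A]| <= #|A| * D.
    move=> h; rewrite -sum_nat_const; apply: leq_trans (leq_sum _ (fun a _ => h a)).
    rewrite -sum1_card (partition_big f (mem A)) /=; last by move=> s; rewrite inE => /andP [].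
    apply: leq_sum => a aA; rewrite -sum1_card; apply: eq_leq; apply: eq_bigl => s.
    by rewrite !inE; case: eqVneq => [->|]; rewrite ?aA ?andbF ?andbT.
  have cJ : #|J| <= #|J'| + 4 * D.
    have h1 := fib _ z (z @: C) hz; have h2 := fib _ w (w @: C) hw.
    have : J \subset J' :|: ([set s in J | z s \in z @: C] :|: [set s in J | w s \in w @: C]).
      by apply/subsetP => s sI; rewrite !inE sI; case: (_ \in _); case: (_ \in _).
    move/subset_leq_card; rewrite !cardsU.
    have := leq_mul z2 (leqnn D); have := leq_mul w2 (leqnn D); lia.
  have [|||F [hF dF]] := IH J'.
  - by move=> a; apply: leq_trans (hz a); apply/subset_leq_card/subsetP => s; rewrite !inE => /andP [/andP [-> _] ->].
  - by move=> a; apply: leq_trans (hw a); apply/subset_leq_card/subsetP => s; rewrite !inE => /andP [/andP [-> _] ->].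
  - have l1 := subset_leq_card (imsetS z sJ); have l2 := subset_leq_card (imsetS w sJ).
    have l3 := leq_mul (leqnn (3 * k)) l2.
    move: hJ; rewrite !mulnS !mulnDl; lia.
  have sep i s t : s \in C -> t \in F i -> z s != z t /\ w s != w t.
    move=> sC tF; have [/subsetP /(_ _ tF) + _] := hF i.
    rewrite inE => /and3P [_ h1 h2]; split.
      by apply: contraNneq h1 => <-; apply: imset_f.
    by apply: contraNneq h2 => <-; apply: imset_f.
  exists (fun i => oapp F C (unlift ord0 i)); split.
    move=> i; case: unliftP => [j _|_] /=; last by [].
    by have [s r] := hF j; split=> //; apply: subset_trans s _.
  move=> i j; case: unliftP => [i' ->|->]; case: unliftP => [j' ->|->] //=.
  + by move=> ne; apply: dF; apply: contraNneq ne => ->.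
  + by move=> _ s t sF tC; have [] := sep _ _ _ tC sF; rewrite ![z t == _]eq_sym ![w t == _]eq_sym.
  + by move=> _ s t; apply: sep.
have noshort F : F \subset J -> ~~ short F by move=> s; have := none F; rewrite /= s => /negbT.
have J0 : w @: J != set0.
  by rewrite -card_gt0 card_gt0 imset_eq0 -card_gt0; lia.
have [|U [hU dU]] := @dense_rich_family _ (quot J) (quot_sym J) (quot_irr noshort) k.+1 _ J0.
  rewrite (arcs_quot noshort).
  have -> : nonrep J :&: lift_set J (w @: J) = nonrep J.
    apply/setIidPl/subsetP => s /(nonrepP noshort) [sJ rJ _ _ _].
    by rewrite inE sJ !imset_f.
  have c := card_nonrep J; lia.
exists (fun i => lift_set J (U i)); split.
  move=> i; have [_ r] := hU i; split; last exact: lift_set_cyclic.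
  by apply/subsetP => s; rewrite inE => /andP [].
move=> i j ne s t; rewrite !inE => /and3P [sJ s1 s2] /and3P [tJ t1 t2].
have /pred0P d := dU _ _ ne.
split; apply/eqP => E.
  by have := d (w (rep J s)); rewrite /= s2 (rep_eq sJ E) t2.
by have := d (w s); rewrite /= s1 E t1.
Qed.

End Multigraph.

(** * Cycles and ears *)

Section Cycles.
Variables (T : finType) (e : rel T).
Hypothesis e_sym : symmetric e.
Hypothesis e_irr : irreflexive e.

Lemma cycle_of_min_degree (U : {set T}) : U != set0 ->
  (forall x, x \in U -> 2 <= cross e [set x] U) ->
  exists c, is_cycle e c /\ all (fun x => x \in U) c.
Proof.
move=> /set0Pn [x0 x0U] deg2.
suff H n x p : #|T| - size p < n -> path e x p -> uniq (x :: p) -> all (fun x => x \in U) (x :: p) ->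
    exists c, is_cycle e c /\ all (fun x => x \in U) c.
  by apply: (H #|T|.+1 x0 [::]) => //=; [lia|rewrite x0U].
elim: n x p => // n IH x p lt pth un al.
have sz : size (x :: p) <= #|T| by rewrite -(card_uniqP un) max_card.
have xU : x \in U by case/andP: al.
have := deg2 _ xU; rewrite cross1l => d2.
(* The path grows at its front [x]: a neighbour other than the next vertex either prolongs it or
   closes a cycle. For empty [p] the default [x] of [head] excludes nothing, as there are no
   loops. *)
have [y [yU exy yh]] : exists y, [/\ y \in U, e x y & y != head x p].
  have := cardsD1 (head x p) [set y in U | e x y] => E.
  have : 0 < #|[set y in U | e x y] :\ head x p| by move: E; case: (_ \in _) => /=; lia.
  rewrite card_gt0 => /set0Pn [y]; rewrite !inE => /and3P [h1 h2 h3].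
  by exists y.
have yx : y != x by apply: contraTneq exy => ->; rewrite e_irr.
have [yp|yp] := boolP (y \in p); last first.
  apply: (IH y (x :: p)) => /=.
  - by move: sz lt => /=; lia.
  - by rewrite e_sym exy.
  - by rewrite inE (negbTE yx) (negbTE yp).
  - by rewrite yU.
case/splitPr: yp yh pth un al sz lt => p1 p2 yh pth un al _ _.
exists (x :: rcons p1 y); split; last first.
  move: al => /=; rewrite all_cat all_rcons /= => /andP [-> /andP [-> /andP [-> _]]] //.
case: p1 yh pth un al => [|a p1] yh pth un al; first by rewrite /= eqxx in yh.
split.
- by rewrite /= size_rcons.
- by move: un; rewrite -cat_rcons -cat_cons cat_uniq => /and3P [].
- move: pth; rewrite -cat_rcons cat_path => /andP [h _].
  by rewrite /cycle rcons_path h last_rcons e_sym.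
Qed.

Lemma rich_cycle (X : {set T}) : rich e X -> exists c, is_cycle e c /\ all (fun x => x \in X) c.
Proof.
move=> rX; have [U UX [rU m]] := minimal_rich_sub rX.
have [aE dE] := minimal_rich_degree e_sym e_irr UX rU m.
have [U0 _] := andP rU.
have [c [cc ca]] := cycle_of_min_degree U0 (fun x xU => eq_leq (esym (dE x xU))).
by exists c; split=> //; apply: sub_all ca => x; apply: (subsetP UX).
Qed.

Lemma not_Ok_free k (X : 'I_k -> {set T}) : (forall i, rich e (X i)) ->
  (forall i j, i != j -> indep e (X i) (X j)) -> ~ Ok_free e k.
Proof.
move=> rX iX ok.
have /fin_all_exists [f hf] i := rich_cycle (rX i).
case: ok; exists f; split=> [i|i j ne x y xi yj]; first by have [] := hf i.
have [_ /allP hi] := hf i; have [_ /allP hj] := hf j.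
exact: (iX i j ne x y (hi _ xi) (hj _ yj)).
Qed.

Variable c : seq T.
Hypothesis c_short : shortest_cycle e c.

Lemma path_rev x (p : seq T) y : path e x (rcons p y) -> path e y (rcons (rev p) x).
Proof.
move=> h; have := rev_path e x (rcons p y).
rewrite last_rcons belast_rcons rev_cons => ->.
by rewrite (eq_path (e' := e)) // => a b; rewrite e_sym.
Qed.

(** The ends split [c] into two arcs, and each arc together with [p] is a cycle, so not shorter than
    [c]; adding the two inequalities gives the bound. With equal ends [u :: p] is itself a cycle,
    unless [p] is one vertex and the ear runs along one edge and back. *)
Lemma ear (u u' : T) (p : seq T) : u \in c -> u' \in c -> uniq p -> all (fun x => x \notin c) p ->
  path e u (rcons p u') -> 0 < size p -> (u = u' /\ size p = 1) \/ size c <= 2 * size p + 2.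
Proof.
move=> uc u'c up ap pp p0; have [[c3 cu cc] m] := c_short.
have notin x : x \in c -> x \notin p.
  by move=> xc; apply/negP => /(allP ap); rewrite xc.
have [E|ne] := eqVneq u u'.
  case: (ltngtP (size p) 1) => [|p1|]; [lia| |by left].
  right; have : is_cycle e (u :: p) by split; rewrite //= ?notin // {2}E.
  by move/m => /=; lia.
right; have [i c' Ec] := rot_to uc.
have u'c' : u' \in c'.
  by move: u'c; rewrite -(mem_rot i) Ec inE eq_sym (negbTE ne).
move: Ec; case/splitPr: u'c' => p1 p2 Ec.
have szc : size c = size p1 + size p2 + 2 by rewrite -(size_rot i) Ec /= size_cat /=; lia.
have unc : uniq (u :: p1 ++ u' :: p2) by rewrite -Ec rot_uniq.
have cyc : cycle e (u :: p1 ++ u' :: p2) by rewrite -Ec rot_cycle.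
have sub x : x \in u :: p1 ++ u' :: p2 -> x \notin p by rewrite -Ec mem_rot; apply: notin.
have [h1 h2] : path e u (rcons p1 u') /\ path e u' (rcons p2 u).
  by move: cyc; rewrite /= rcons_cat rcons_cons -cat_rcons cat_path last_rcons => /andP.
have c1 : is_cycle e (u' :: p2 ++ u :: p).
  split; first by rewrite /= size_cat /= addnS !ltnS ltn_addl.
    move: unc; rewrite -cat_cons uniq_catC -cat_rcons cat_uniq => /andP [h _].
    rewrite -cat_cons -cat_rcons cat_uniq h up andbT /=; apply/hasPn => x xp.
    apply: contraTN xp => xs; apply: sub.
    have {xs} : x \in rcons (u' :: p2) u := xs.
    rewrite mem_rcons !inE mem_cat !inE; do !case: (_ == _); rewrite ?orbT //=.
    by move=> ->; rewrite ?orbT.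
  by rewrite /= rcons_cat rcons_cons -cat_rcons cat_path h2 last_rcons.
have c2 : is_cycle e (u :: p1 ++ u' :: rev p).
  split; first by rewrite /= size_cat /= size_rev addnS !ltnS ltn_addl.
    move: unc; rewrite -cat_cons -cat_rcons cat_uniq => /andP [h _].
    rewrite -cat_cons -cat_rcons cat_uniq h rev_uniq up andbT /=.
    apply/hasPn => x; rewrite mem_rev => xp; apply: contraTN xp => xs; apply: sub.
    have {xs} : x \in rcons (u :: p1) u' := xs.
    rewrite mem_rcons !inE mem_cat !inE; do !case: (_ == _); rewrite ?orbT //=.
    by move=> ->; rewrite ?orbT.
  by rewrite /= rcons_cat rcons_cons -cat_rcons cat_path h1 last_rcons path_rev.
have arith a b d n : n = a + b + 2 -> n <= (a + d.+1).+1 -> n <= (b + d.+1).+1 -> n <= 2 * d + 2.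
  by lia.
have := m _ c1; have := m _ c2; rewrite /= !size_cat /= size_rev => l1 l2.
exact: arith szc l1 l2.
Qed.

(** A chord would close a shorter cycle with the segment between its ends. The second alternative is
    the edge from the last entry of the list back to the first. *)
Lemma chord (u u' : T) : u \in c -> u' \in c -> index u c < index u' c -> e u u' ->
  index u' c = (index u c).+1 \/ (index u c = 0 /\ index u' c = (size c).-1).
Proof.
move=> uc; have [[c3 cu cc] m] := c_short.
move: cu cc m c3; case/splitPr: uc => c1 c2 un cyc m _ u'c lt euu.
have u1 : u \notin c1 by move: un; rewrite cat_uniq /= negb_or => /and3P [_ /andP []].
have Eu : index u (c1 ++ u :: c2) = size c1 by rewrite index_cat (negbTE u1) /= eqxx addn0.
rewrite Eu in lt *.
have u'1 : u' \notin c1.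
  apply/negP => h; move: lt; rewrite index_cat h => lt.
  by move: h; rewrite -index_mem; lia.
have ne : u' != u by apply: contraTneq lt => ->; rewrite Eu ltnn.
have : u' \in c2 by move: u'c; rewrite mem_cat inE (negbTE u'1) (negbTE ne).
move=> h; move: un cyc m u'c lt; case/splitPr: h => c2' c3 un cyc m u'c lt.
have u'2 : u' \notin c2'.
  move: un; rewrite cat_uniq => /and3P [_ _ /= /andP [_]].
  by rewrite cat_uniq /= negb_or => /and3P [_ /andP []].
have Eu' : index u' (c1 ++ u :: c2' ++ u' :: c3) = size c1 + (size c2').+1.
  by rewrite index_cat (negbTE u'1) /= eq_sym (negbTE ne) index_cat (negbTE u'2) /= eqxx addn0.
rewrite Eu'; case: (posnP (size c2')) => [->|c2p]; [by left; rewrite addn1|right].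
have : is_cycle e (u :: rcons c2' u').
  split; first by rewrite /= size_rcons !ltnS.
    move: un; rewrite cat_uniq => /and3P [_ _].
    by rewrite -cat_rcons -cat_cons cat_uniq => /andP [].
  move: cyc; rewrite -(rot_cycle (size c1)) rot_size_cat /= -cat_rcons -catA rcons_cat cat_path => /andP [h _].
  by rewrite /= rcons_path h last_rcons e_sym euu.
move/m; rewrite /= size_rcons !size_cat /= size_cat /=.
by move: (size c1) (size c2') (size c3) => a1 a2 a3; lia.
Qed.

Lemma cycle_nth x0 i : i.+1 < size c -> e (nth x0 c i) (nth x0 c i.+1).
Proof.
move=> lt; have [[_ _ cc] _] := c_short.
case: c cc lt => // a p /= h lt.
by move: h; rewrite rcons_path => /andP [/(pathP x0)/(_ i lt)].
Qed.

End Cycles.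

(** * The neighbourhood of a shortest cycle *)

Section Rank.
Variables (T : finType) (e : rel T).
Hypothesis e_sym : symmetric e.
Hypothesis e_irr : irreflexive e.

Lemma n_edges_le : 2 * n_edges e <= arcs e [set: T].
Proof.
pose E := [set A : {set T} | [exists x, [exists y, e x y && (A == [set x; y])]]].
have -> : arcs e [set: T] = \sum_(p : T * T | e p.1 p.2) 1.
  rewrite /arcs /cross [RHS]big_mkcond /=.
  rewrite -(pair_big xpredT xpredT (fun x y : T => if e x y then 1 else 0)) /=.
  apply: eq_big => [x|x _]; first by rewrite inE.
  by apply: eq_big => [y|y _]; rewrite ?inE //; case: (e x y).
rewrite (partition_big (fun p => [set p.1; p.2]) (mem E)) /=; last first.
  move=> [x y] /= exy; rewrite inE; apply/existsP; exists x; apply/existsP; exists y.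
  by rewrite exy eqxx.
rewrite /n_edges -/E mulnC -sum_nat_const; apply: leq_sum => A.
rewrite inE => /existsP [x /existsP [y /andP [exy /eqP ->]]].
have ne : x != y by apply: contraTneq exy => ->; rewrite e_irr.
rewrite (bigD1 (x, y)) /= ?exy ?eqxx // (bigD1 (y, x)) /=; first by lia.
by rewrite e_sym exy setUC eqxx /= xpair_eqE negb_and eq_sym ne.
Qed.

Lemma n_components_le1 : connected_graph e -> n_components e <= 1.
Proof.
move=> conn; apply/card_le1P => _ /imsetP [x _ ->] y; rewrite inE.
apply/imsetP/eqP => [[z _ ->]|->]; last by exists x.
by symmetry; apply/(fingraph.rootP (sym_connect_sym e_sym)); apply: conn.
Qed.
End Rank.


Section ShortestCycle.
Variables (T : finType) (e : rel T) (c : seq T).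
Hypothesis e_sym : symmetric e.
Hypothesis e_irr : irreflexive e.
Hypothesis girth : girth_ge e 11.
Hypothesis c_short : shortest_cycle e c.

Local Notation C := [set x in c].
Local Notation N := (nbhd_out e c).
Local Notation R := (rest e c).

Let size_c : 11 <= size c. Proof. by apply: girth; case: c_short. Qed.

Lemma nbhdP n : n \in N -> n \notin c /\ exists2 u, u \in c & e n u.
Proof.
rewrite inE => /andP [h /existsP [u /andP [uc enu]]]; split=> //; by exists u.
Qed.

Lemma restP r : r \in R -> r \notin c /\ r \notin N.
Proof. by rewrite inE => /andP. Qed.

Lemma rest_cycle_nonadj r u : r \in R -> u \in c -> ~~ e r u.
Proof.
move=> /restP [rc rN] uc; apply: contra rN => eru.
by rewrite inE rc; apply/existsP; exists u; rewrite uc.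
Qed.

(** The girth enters here: an ear with four inner vertices would bound the length of [c] by 10. Four
    are needed for the ear through two feet and two adjacent vertices attached to them. *)
Lemma short_ear (u u' : T) (p : seq T) : u \in c -> u' \in c -> uniq p -> all (fun x => x \notin c) p ->
  path e u (rcons p u') -> 0 < size p <= 4 -> u = u' /\ size p = 1.
Proof.
move=> uc u'c up ap pp /andP [p0 p4].
by case: (ear e_sym c_short uc u'c up ap pp p0) => // h; have := leq_trans size_c h; lia.
Qed.

Lemma attachment_unique n u u' : n \in N -> u \in c -> u' \in c -> e n u -> e n u' -> u = u'.
Proof.
move=> /nbhdP [nc _] uc u'c enu enu'.
by case: (@short_ear u u' [:: n]) => //=; rewrite ?nc // e_sym enu enu'.
Qed.

Lemma nbhd_indep n n' : n \in N -> n' \in N -> ~~ e n n'.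
Proof.
move=> /nbhdP [nc [u uc enu]] /nbhdP [nc' [u' uc' enu']]; apply/negP => enn.
have ne : n != n' by apply: contraTneq enn => ->; rewrite e_irr.
case: (@short_ear u u' [:: n; n']) => //=; first by rewrite inE ne.
  by rewrite nc nc'.
by rewrite e_sym enu enn enu'.
Qed.

Lemma rest_nbhd_unique r n n' : r \in R -> n \in N -> n' \in N -> e r n -> e r n' -> n = n'.
Proof.
move=> rR nN nN' ern ern'; apply/eqP/negP => /negP ne.
have [rc rN] := restP rR.
have [nc [u uc enu]] := nbhdP nN; have [nc' [u' uc' enu']] := nbhdP nN'.
case: (@short_ear u u' [:: n; r; n']) => //=.
- rewrite !inE negb_or ne !andbT /=.
  by apply/andP; split; [apply: contraNneq rN => <-|apply: contraNneq rN => ->].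
- by rewrite nc rc nc'.
- by rewrite e_sym enu e_sym ern ern' enu'.
Qed.

Lemma attached_indep s s' n n' : s \in R -> s' \in R -> n \in N -> n' \in N ->
  e s n -> e s' n' -> ~~ e s s'.
Proof.
move=> sR sR' nN nN' esn esn'; apply/negP => ess.
have ne : s != s' by apply: contraTneq ess => ->; rewrite e_irr.
have [sc sN] := restP sR; have [sc' sN'] := restP sR'.
have [nc [u uc enu]] := nbhdP nN; have [nc' [u' uc' enu']] := nbhdP nN'.
have nR m t : m \in N -> t \notin N -> m != t by move=> mN; apply: contraNneq => <-.
have [E|nn] := eqVneq n n'.
  suff /girth : is_cycle e [:: n; s; s'] by [].
  split; rewrite //= ?inE ?negb_or ?ne ?(nR n s) ?(nR n s') //.
  by rewrite e_sym esn ess E esn'.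
case: (@short_ear u u' [:: n; s; s'; n']) => //=.
- rewrite !inE !negb_or nn ne (nR n s) // (nR n s') //.
  by rewrite [s == n']eq_sym [s' == n']eq_sym (nR n' s) // (nR n' s').
- by rewrite nc sc sc' nc'.
- by rewrite e_sym enu e_sym esn ess esn' enu'.
Qed.

Definition attached := [set s in R | [exists n in N, e s n]].
Definition foot s := odflt s [pick n in N | e s n].
Definition base n := odflt n [pick u in C | e n u].

Lemma footP s : s \in attached -> foot s \in N /\ e s (foot s).
Proof.
rewrite inE => /andP [_ /existsP [n h]]; rewrite /foot; case: pickP => [m /andP []|/(_ n)] //=.
by rewrite h.
Qed.

Lemma attachedP s n : s \in R -> n \in N -> e s n -> s \in attached /\ foot s = n.
Proof.
move=> sR nN esn.
have sA : s \in attached by rewrite inE sR; apply/existsP; exists n; rewrite nN.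
by split=> //; have [fN ef] := footP sA; apply: rest_nbhd_unique ef esn.
Qed.

Lemma baseP n : n \in N -> base n \in c /\ e n (base n).
Proof.
move=> /nbhdP [_ [u uc enu]]; rewrite /base; case: pickP => [m /andP []|/(_ u)] /=.
  by rewrite inE.
by rewrite inE uc enu.
Qed.

Lemma base_unique n u : n \in N -> u \in c -> e n u -> u = base n.
Proof. by move=> nN uc enu; have [bc eb] := baseP nN; apply: attachment_unique enu eb. Qed.

Lemma cycle_degree x : x \in c -> cross e [set x] C <= 2.
Proof.
move=> xc; rewrite cross1l.
have xi : index x c < size c by rewrite index_mem.
pose l := size c; pose i := index x c.
(* These are the cyclic successor and predecessor of [x]; adding [l.-1] modulo [l] steps back by
   one. *)
apply: (@leq_trans #|[set nth x c ((i.+1) %% l); nth x c ((i + l.-1) %% l)]|); last first.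
  by rewrite cards2; case: (_ != _).
apply/subset_leq_card/subsetP => y; rewrite !inE => /andP [yc exy].
have yi : index y c < size c by rewrite index_mem.
have ne : index x c != index y c.
  by apply: contraTneq exy => /(index_inj x xc yc) ->; rewrite e_irr.
suff : (index y c == i.+1 %% l) || (index y c == (i + l.-1) %% l).
  by case/orP => /eqP <-; rewrite nth_index // eqxx ?orbT.
have eyx : e y x by rewrite e_sym.
have [[c3 _ _] _] := c_short.
case: (ltngtP (index x c) (index y c)) ne => // lt _.
- case: (chord e_sym c_short xc yc lt exy) => [E|[E1 E2]].
  + by rewrite E modn_small ?eqxx // -/i -E.
  + by rewrite /i E1 E2 add0n [l.-1 %% l]modn_small ?eqxx ?orbT // /l ltn_predL; exact: leq_trans size_c.
- case: (chord e_sym c_short yc xc lt eyx) => [E|[E1 E2]].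
  + rewrite /i E addSnnS prednK; last exact: leq_trans size_c.
    by rewrite modnDr [index y c %% l]modn_small ?eqxx ?orbT.
  + by rewrite /i E2 E1 prednK ?modnn ?eqxx ?orbT //; exact: leq_trans size_c.
Qed.

(** The rank bound in doubled form. The cycle has no chords, [N] is independent and sends one edge
    per vertex to [C], each vertex of [attached] sends one edge to [N], and there are no edges
    between [C] and [R]. *)
Lemma arcs_total : arcs e [set: T] + 2 * #|R| <= 2 * #|T| + 2 * #|attached| + arcs e R.
Proof.
have dCN : [disjoint C & N].
  rewrite -setI_eq0; apply/eqP/setP => x; rewrite in_setI in_set0; apply/negP => /andP [].
  by rewrite inE => xc /nbhdP [] /negP.
have dU : [disjoint C :|: N & R].
  rewrite -setI_eq0; apply/eqP/setP => x; rewrite in_setI in_set0; apply/negP => /andP [].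
  by rewrite in_setU inE => h /restP []; case/orP: h => ->.
have ET : [set: T] = (C :|: N) :|: R.
  apply/setP => x; rewrite in_setT !in_setU [x \in R]in_set [x \in C]in_set.
  by case: (x \in c) => //=; rewrite orbN.
have cT : #|T| = #|C| + #|N| + #|R|.
  rewrite -cardsT ET.
  have := cardsUI (C :|: N) R; have := cardsUI C N.
  by rewrite (disjoint_setI0 dCN) (disjoint_setI0 dU) cards0; lia.
rewrite ET !arcsU //.
have -> : arcs e N = 0 by apply: cross_eq0 => a b; apply: nbhd_indep.
have h1 : arcs e C <= 2 * #|C|.
  by apply: cross_leM => x; rewrite inE; apply: cycle_degree.
have h2 : cross e C N <= #|N|.
  rewrite crossC // -[#|N|]mul1n; apply: cross_leM => n nN; rewrite cross1l.
  apply: leq_trans (_ : #|[set base n]| <= 1); last by rewrite cards1.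
  apply/subset_leq_card/subsetP => u; rewrite !inE => /andP [uc enu].
  by apply/eqP; apply: base_unique.
have h3 : cross e (C :|: N) R <= #|attached|.
  rewrite crossC // crossUr // (cross_eq0 (Y := C)); last first.
    by move=> r u rR; rewrite inE; apply: rest_cycle_nonadj.
  rewrite add0n.
  have -> : cross e R N = cross e attached N.
    rewrite -(setID R attached) crossUl; last first.
      rewrite -setI_eq0; apply/eqP/setP => x; rewrite !in_setI in_setD in_set0.
      by case: (x \in attached); rewrite ?andbF.
    rewrite (setIidPr _); last by apply/subsetP => s; rewrite inE => /andP [].
    rewrite [X in _ + X]cross_eq0 ?addn0 // => r n /setDP [rR rA] nN; apply: contra rA => ern.
    by have [] := attachedP rR nN ern.
  rewrite -[#|_|]mul1n; apply: cross_leM => s sA; rewrite cross1l.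
  apply: leq_trans (_ : #|[set foot s]| <= 1); last by rewrite cards1.
  apply/subset_leq_card/subsetP => n; rewrite in_set1 [n \in _]in_set => /andP [nN esn].
  have sR : s \in R by move: sA; rewrite inE => /andP [].
  by have [_ ->] := attachedP sR nN esn; rewrite eqxx.
rewrite cT; lia.
Qed.

End ShortestCycle.

(** * Spiders in a forest *)

Section Spiders.
Variables (T : finType) (e : rel T) (S : {set T}) (D : nat).
Hypothesis e_sym : symmetric e.
Implicit Types (X Y Z J Q : {set T}).

(* [J] is a set of leg ends, [ctr] maps each of them to a label of its spider, [F J'] is the union
   of the legs that end in [J'] and of their centres, and [col] colours the spiders so that
   distinct spiders of the same colour are independent. The label is the centre if the centre
   is in [S]; otherwise it is only used to tell spiders apart. *)
Record spider_system Y J (ctr : T -> T) (F : {set T} -> {set T}) (col : T -> bool) : Prop :=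
  SpiderSystem {
    sys_sub : J \subset S :&: Y;
    sys_ctr : forall s, s \in J -> [/\ ctr s \in Y, col (ctr s) = col s & ctr s \in S -> ctr s != s];
    sys_fibre : forall a, #|[set s in J | ctr s == a]| <= D;
    sys_part : forall b J', J' \subset [set s in J | col s == b] ->
      [/\ J' \subset F J', F J' \subset [set y in Y | col y == b],
          F J' :&: S \subset J' :|: ctr @: J',
          2 * #|F J'| <= arcs e (F J') + 2 * #|ctr @: J'| &
          S :&: ctr @: J' \subset F J'];
    sys_indep : forall b J' J'',
      J' \subset [set s in J | col s == b] -> J'' \subset [set s in J | col s == b] ->
      (forall s t, s \in J' -> t \in J'' -> ctr s != ctr t) -> indep e (F J') (F J'')
  }.

(** A single spider, with centre [a], before it joins a system. The bound on [#|F J'|] is the edge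
    count of a tree. It is asked for nonempty [J'] because a spider of which no leg is used must
    disappear from the system's [F] with its centre: [ctr @: J'] would not pay for it. *)
Record spider Z J (a : T) (F : {set T} -> {set T}) : Prop := Spider {
    spi_sub : J \subset S :&: Z;
    spi_ctr : a \in Z;
    spi_ctrS : a \in S -> a \notin J;
    spi_size : #|J| <= D;
    spi_part : forall J', J' \subset J -> J' != set0 ->
      [/\ J' \subset F J', F J' \subset Z, F J' :&: S \subset a |: J',
          2 * #|F J'| <= arcs e (F J') + 2 & a \in S -> a \in F J']
  }.

Lemma spider_system_sub Y Y' J ctr F col : Y \subset Y' ->
  spider_system Y J ctr F col -> spider_system Y' J ctr F col.
Proof.
move=> YY [h1 h2 h3 h4 h5]; split=> //.
- by apply: subset_trans h1 _; apply: setIS.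
- by move=> s /h2 [a b d]; split=> //; apply: (subsetP YY).
- move=> b J' /h4 [a1 a2 a3 a4 a5]; split=> //.
  by apply: subset_trans a2 _; apply/subsetP => y; rewrite !inE => /andP [/(subsetP YY) -> ->].
Qed.

(** This produces the 2-colouring. The only vertex of [Y] with a neighbour in [Z] is [p], so
    colouring all of [Z] opposite to [p] leaves no edge between [Z] and the vertices of [Y] of the
    same colour. *)
Lemma spider_glue Y Z J0 ctr0 F0 col0 JZ a FZ p :
  spider_system Y J0 ctr0 F0 col0 -> spider Z JZ a FZ -> [disjoint Y & Z] ->
  (forall x y, x \in Z -> y \in Y -> e x y -> y = p) ->
  exists ctr F col, spider_system (Y :|: Z) (J0 :|: JZ) ctr F col /\
     #|ctr @: (J0 :|: JZ)| <= #|ctr0 @: J0|.+1.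
Proof.
move=> [h1 h2 h3 h4 h5] [k1 k2 k3 k4 k5] dYZ adj.
pose ctr s := if s \in Z then a else ctr0 s.
pose col s := if s \in Z then ~~ col0 p else col0 s.
pose FF J' := if J' :&: JZ == set0 then set0 else FZ (J' :&: JZ).
pose F J' := F0 (J' :&: J0) :|: FF J'.
have YZ y : y \in Y -> (y \in Z) = false.
  by move=> yY; apply/negbTE; move: dYZ; rewrite disjoints_subset => /subsetP /(_ _ yY); rewrite inE.
have J0Y s : s \in J0 -> s \in Y by move/(subsetP h1); rewrite inE => /andP [].
have JZZ s : s \in JZ -> s \in Z by move/(subsetP k1); rewrite inE => /andP [].
have J0S s : s \in J0 -> s \in S by move/(subsetP h1); rewrite inE => /andP [].
have JZS s : s \in JZ -> s \in S by move/(subsetP k1); rewrite inE => /andP [].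
have ctrE0 s : s \in J0 -> ctr s = ctr0 s by move=> /J0Y /YZ h; rewrite /ctr h.
have ctrEZ s : s \in JZ -> ctr s = a by move=> /JZZ h; rewrite /ctr h.
have sub0 b J' : J' \subset [set s in J0 :|: JZ | col s == b] ->
    J' :&: J0 \subset [set s in J0 | col0 s == b].
  move=> sJ; apply/subsetP => s; case/setIP => /(subsetP sJ) + sJ0; rewrite !inE.
  by rewrite sJ0 /col (YZ _ (J0Y _ sJ0)).
have FFE b J' : J' \subset [set s in J0 :|: JZ | col s == b] ->
    FF J' = set0 \/ [/\ J' :&: JZ != set0, FF J' = FZ (J' :&: JZ) & ~~ col0 p = b].
  move=> sJ; rewrite /FF; case: eqVneq => [_|ne]; [by left|right; split=> //].
  have /set0Pn [s /setIP [/(subsetP sJ) + sZ]] := ne.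
  by rewrite !inE /col (JZZ _ sZ) => /andP [_ /eqP].
have splitJ b J' : J' \subset [set s in J0 :|: JZ | col s == b] -> 
   J' = (J' :&: J0) :|: (J' :&: JZ).
  move=> sJ; rewrite -setIUr; apply/esym/setIidPl; apply: subset_trans sJ _.
  by apply/subsetP => s; rewrite inE => /andP [].
have FFZ b J' : J' \subset [set s in J0 :|: JZ | col s == b] -> FF J' \subset Z.
  move=> /FFE [->|[ne -> _]]; first exact: sub0set.
  by have [] := k5 _ (subsetIr _ _) ne.
have F0Y b J' : J' \subset [set s in J0 :|: JZ | col s == b] ->
    F0 (J' :&: J0) \subset [set y in Y | col0 y == b].
  by move=> /sub0 /h4 [].
exists ctr, F, col; split; last first.
  rewrite imsetU; apply: leq_trans (_ : #|ctr0 @: J0 :|: [set a]| <= _); last first.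
    by rewrite cardsU cards1; lia.
  apply/subset_leq_card/setUSS; apply/subsetP => x /imsetP [s sJ ->].
    by rewrite ctrE0 // imset_f.
  by rewrite ctrEZ // set11.
split.
- by rewrite subUset; apply/andP; split; [apply: subset_trans h1 _|apply: subset_trans k1 _];
    apply: setIS; rewrite ?subsetUl ?subsetUr.
- move=> s; rewrite inE => /orP [sJ|sJ].
    have [a1 a2 a3] := h2 _ sJ; rewrite ctrE0 //; split=> //; first by rewrite inE a1.
    by rewrite /col (YZ _ (J0Y _ sJ)) YZ.
  rewrite ctrEZ //; split; first by rewrite inE k2 orbT.
    by rewrite /col k2 (JZZ _ sJ).
  by move=> /k3; apply: contraNneq => ->.
- move=> x; have [xZ|xZ] := boolP (x \in Z).
    apply: leq_trans k4; apply/subset_leq_card/subsetP => s; rewrite !inE => /andP [/orP [sJ|] //].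
    rewrite ctrE0 // => /eqP E; have [a1 _ _] := h2 _ sJ.
    by move: xZ; rewrite -E YZ.
  apply: leq_trans (h3 x); apply/subset_leq_card/subsetP => s; rewrite !inE => /andP [/orP [sJ|sJ]].
    by rewrite sJ ctrE0.
  by rewrite ctrEZ // => /eqP E; move: xZ; rewrite -E k2.
- move=> b J' sJ; have [a1 a2 a3 a4 a5] := h4 _ _ (sub0 _ _ sJ).
  have E := splitJ _ _ sJ.
  have im0 : ctr @: (J' :&: J0) = ctr0 @: (J' :&: J0).
    by apply: eq_in_imset => s /setIP [_ /ctrE0].
  have F0Y' : F0 (J' :&: J0) \subset Y.
    by apply: subset_trans a2 _; apply/subsetP => y; rewrite inE => /andP [].
  have F0c : F0 (J' :&: J0) \subset [set y in Y :|: Z | col y == b].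
    apply: subset_trans a2 _; apply/subsetP => y; rewrite !inE => /andP [yY /eqP <-].
    by rewrite yY /col YZ // eqxx.
  case: (FFE _ _ sJ) => [FE|[ne FE cb]].
    have JE : J' :&: JZ = set0.
      move: FE; rewrite /FF; case: eqVneq => // ne FE.
      have [b1 _ _ _ _] := k5 _ (subsetIr J' JZ) ne.
      by apply/eqP; rewrite -subset0 -FE.
    have E' : J' :&: J0 = J' by rewrite {2}E JE setU0.
    by rewrite /F FE setU0; move: a1 a2 a3 a4 a5 im0 F0c; rewrite E' => ? ? ? ? ? -> ?.
  have [b1 b2 b3 b4 b5] := k5 _ (subsetIr J' JZ) ne.
  have imZ : ctr @: (J' :&: JZ) = [set a].
    apply/setP => x; rewrite inE; apply/imsetP/eqP => [[s /setIP [_ /ctrEZ ->]]|->] //.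
    by have /set0Pn [s sI] := ne; exists s => //; rewrite ctrEZ //; case/setIP: sI.
  have imE : ctr @: J' = ctr0 @: (J' :&: J0) :|: [set a] by rewrite {1}E imsetU im0 imZ.
  have dF : [disjoint F0 (J' :&: J0) & FZ (J' :&: JZ)] by apply: disjointWl F0Y' _; apply: disjointWr b2 _.
  rewrite /F FE imE; split.
  + by rewrite {1}E; apply: setUSS.
  + rewrite subUset F0c /=; apply: subset_trans b2 _; apply/subsetP => y yZ.
    by rewrite !inE yZ orbT /col yZ cb eqxx.
  + rewrite setIUl subUset; apply/andP; split.
      apply: subset_trans a3 _; rewrite setUA; apply: subset_trans (subsetUl _ _).
      exact/setSU/subsetIl.
    by apply: subset_trans b3 _; apply/subsetP => y; rewrite !inE => /orP [->|/andP [-> _]]; rewrite ?orbT.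
  + rewrite arcsU // cardsU (disjoint_setI0 dF) cards0 cardsU.
    rewrite (_ : _ :&: [set a] = set0) ?cards0 ?cards1.
      by move: a4 b4; clear; lia.
    apply/eqP; rewrite setI_eq0 disjoint_sym disjoints1; apply/imsetP => [[s /setIP [_ sJ0] Ea]].
    by have [c1 _ _] := h2 _ sJ0; move: k2; rewrite Ea YZ.
  + rewrite setIUr subUset; apply/andP; split; first by apply: subset_trans a5 (subsetUl _ _).
    by apply/subsetP => y; rewrite !inE => /andP [yS /eqP Ey]; rewrite Ey b5 ?orbT // -Ey.
- move=> b J' J'' sJ' sJ'' dis.
  have key (A B : {set T}) : A \subset [set s in J0 :|: JZ | col s == b] -> B \subset [set s in J0 :|: JZ | col s == b] ->
      indep e (F0 (A :&: J0)) (FF B).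
    move=> sA sB x y xF yF.
    have := subsetP (F0Y _ _ sA) _ xF; rewrite inE => /andP [xY /eqP cx].
    case: (FFE _ _ sB) => [FE|[ne FE cb]]; first by rewrite FE inE in yF.
    have yZ := subsetP (FFZ _ _ sB) _ yF.
    split; first by apply: contraTneq yZ => <-; rewrite YZ.
    apply/negP => exy; rewrite e_sym in exy.
    by move: cb; rewrite -cx (adj _ _ yZ xY exy); case: (col0 p).
  move=> x y /setUP [xF|xF] /setUP [yF|yF].
  + apply: (h5 b _ _ (sub0 _ _ sJ') (sub0 _ _ sJ'') _ x y xF yF) => s t /setIP [s1 s2] /setIP [t1 t2].
    by rewrite -!ctrE0 // dis.
  + exact: key xF yF.
  + by have [n1 n2] := key _ _ sJ'' sJ' _ _ yF xF; rewrite eq_sym e_sym.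
  + case: (FFE _ _ sJ') => [FE|[ne _ _]]; first by rewrite FE inE in xF.
    case: (FFE _ _ sJ'') => [FE|[ne' _ _]]; first by rewrite FE inE in yF.
    have /set0Pn [s /setIP [s1 s2]] := ne; have /set0Pn [t /setIP [t1 t2]] := ne'.
    by have := dis _ _ s1 t1; rewrite !ctrEZ // eqxx.
Qed.

End Spiders.

(* [lia] compares its atoms up to conversion, which is hopeless on cardinals of explicit sets. *)
Ltac card_lia :=
  repeat match goal with
  | H : is_true (leq _ _) |- _ => revert H
  | H : @eq nat _ _ |- _ => revert H
  end;
  clear;
  repeat match goal with
  | |- context [@cross ?T ?e ?A ?B] => generalize (@cross T e A B); intro
  | |- context [@arcs ?T ?e ?A] => generalize (@arcs T e A); intro
  | |- context [@card.body ?T ?m] => generalize (@card.body T m); intro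
  end;
  lia.

(** * Stripping leaves of the forest *)

Section Strip.
Variables (T : finType) (e : rel T) (S : {set T}) (D : nat).
Hypothesis e_sym : symmetric e.
Hypothesis e_irr : irreflexive e.
Hypothesis S_indep : forall s s', s \in S -> s' \in S -> ~~ e s s'.
Hypothesis D2 : 2 <= D.
Hypothesis degD : forall x, #|[set y | e x y]| <= D.
Implicit Types (U X Y Z J Q L : {set T}) (leg : T -> {set T}).

(** A stripped leg with end [s] that hangs from the vertex [x] of the remaining forest [X].
    [leg_adj] keeps it independent of whatever is stripped later, until [x] itself is removed. *)
Record leg_at X L (s x : T) : Prop := LegAt {
    leg_S : s \in S;
    leg_top : x \in X;
    leg_disj : [disjoint L & X];
    leg_foot : s \in L;
    leg_clean : L :&: S \subset [set s];
    leg_tree : 2 * #|L| <= arcs e L + 2;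
    leg_adj : forall y z, y \in L -> z \in X -> e y z -> z = x;
    leg_link : exists2 y, y \in L & e y x
  }.

(* The state of the leaf stripping: [X] is the part of the forest that is left, and [Q] the set
   of ends of the legs that were stripped and hang from [X]. *)
Record pending X Q (leg : T -> {set T}) (at_ : T -> T) : Prop := Pending {
    pend_leg : forall s, s \in Q -> leg_at X (leg s) s (at_ s);
    pend_indep : forall s t, s \in Q -> t \in Q -> s != t -> indep e (leg s) (leg t)
  }.

Definition legs Q (leg : T -> {set T}) := \bigcup_(s in Q) leg s.

Lemma legsP Q leg (x : T) : reflect (exists2 s, s \in Q & x \in leg s) (x \in legs Q leg).
Proof. exact: bigcupP. Qed.

Lemma legs_sub Q (Q' : {set T}) leg : Q \subset Q' -> legs Q leg \subset legs Q' leg.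
Proof.
move=> QQ; apply/subsetP => x /legsP [s sQ xs]; apply/legsP; exists s => //.
exact: (subsetP QQ).
Qed.

Lemma star_arcs X Q leg v : (forall s, s \in Q -> leg_at X (leg s) s v) ->
  (forall s t, s \in Q -> t \in Q -> s != t -> indep e (leg s) (leg t)) ->
  2 * #|v |: legs Q leg| <= arcs e (v |: legs Q leg) + 2.
Proof.
have [n] := ubnP #|Q|; elim: n Q => // n IH Q lt hl hi.
have [Q0|[s sQ]] := set_0Vmem Q.
  by rewrite Q0 /legs big_set0 setU0 cards1; card_lia.
have E : legs Q leg = leg s :|: legs (Q :\ s) leg.
  by rewrite /legs (big_setD1 s).
have sub : Q :\ s \subset Q by apply: subsetDl.
have IHs := IH (Q :\ s) _ (fun t tQ => hl t (subsetP sub _ tQ)) 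
  (fun t t' tQ tQ' => hi t t' (subsetP sub _ tQ) (subsetP sub _ tQ')).
have {IHs} : 2 * #|v |: legs (Q :\ s) leg| <= arcs e (v |: legs (Q :\ s) leg) + 2.
  by apply: IHs; have := cardsD1 s Q; rewrite sQ; card_lia.
rewrite E setUCA; set B := v |: _ => IHs.
have [_ vX dX _ _ tr _ [y yL eyv]] := hl _ sQ.
have d : [disjoint leg s & B].
  rewrite -setI_eq0; apply/eqP/setP => x; rewrite in_setI in_set0; apply/negP => /andP [xs].
  rewrite in_setU1 => /orP [/eqP E'|/legsP [t /setD1P [ne tQ] xt]].
    by move: dX; rewrite disjoints_subset => /subsetP /(_ _ xs); rewrite inE E' vX.
  by have [/eqP] := hi _ _ tQ sQ ne _ _ xt xs.
have c0 : 0 < cross e (leg s) B by apply: cross_gt0 yL _ eyv; rewrite setU11.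
rewrite arcsU // cardsU (disjoint_setI0 d) cards0; card_lia.
Qed.

Lemma star_spider X Q leg v : (forall s, s \in Q -> leg_at X (leg s) s v) ->
  (forall s t, s \in Q -> t \in Q -> s != t -> indep e (leg s) (leg t)) ->
  spider e S D (v |: legs Q leg) Q v (fun J => v |: legs J leg).
Proof.
move=> hl hi; split.
- apply/subsetP => s sQ; have [sS _ _ sL _ _ _ _] := hl _ sQ.
  by rewrite in_setI sS in_setU1; apply/orP; right; apply/legsP; exists s.
- exact: setU11.
- move=> _; apply/negP => vQ; have [_ vX dX vL _ _ _ _] := hl _ vQ.
  by move: dX; rewrite disjoints_subset => /subsetP /(_ _ vL); rewrite inE vX.
- apply: leq_trans (degD v).
  (* Distinct legs contain distinct neighbours of [v], so the degree bound limits their number. *)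
  pose f s := odflt s [pick y in leg s | e v y].
  have fP s : s \in Q -> f s \in leg s /\ e v (f s).
    move=> sQ; have [_ _ _ _ _ _ _ [y yL eyv]] := hl _ sQ.
    rewrite /f; case: pickP => [z /andP []|/(_ y)] //=.
    by rewrite e_sym eyv yL.
  rewrite -(card_in_imset (f := f)); last first.
    move=> s t sQ tQ E; apply/eqP/negP => /negP ne.
    have [fs _] := fP _ sQ; have [ft _] := fP _ tQ.
    by have [/eqP] := hi _ _ sQ tQ ne _ _ fs ft.
  by apply/subset_leq_card/subsetP => x /imsetP [s sQ ->]; rewrite inE; case: (fP _ sQ).
- move=> J JQ J0; split.
  + apply/subsetP => s sJ; have [_ _ _ sL _ _ _ _] := hl _ (subsetP JQ _ sJ).
    by rewrite in_setU1; apply/orP; right; apply/legsP; exists s.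
  + exact/setUS/legs_sub.
  + apply/subsetP => x /setIP [+ xS]; rewrite !in_setU1 => /orP [->//|/legsP [s sJ xs]].
    have [_ _ _ _ cl _ _ _] := hl _ (subsetP JQ _ sJ).
    have : x \in [set s] by apply: (subsetP cl); rewrite inE xs.
    by move=> /set1P ->; rewrite sJ orbT.
  + by apply: (@star_arcs X) => [s sJ|s t sJ tJ]; [apply: hl|apply: hi]; apply: (subsetP JQ).
  + by move=> _; apply: setU11.
Qed.

(* The centre is a neighbour of [v] on the leg: it lies outside [S], as [S] is independent. *)
Lemma path_spider X L s v : leg_at X L s v -> v \in S ->
  exists t F, spider e S D (v |: L) [set s; v] t F.
Proof.
move=> [sS vX dX sL cl tr ad [t tL etv]] vS.
have vL : v \notin L.
  by apply/negP => vL; move: dX; rewrite disjoints_subset => /subsetP /(_ _ vL); rewrite inE vX.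
have tS : t \notin S by apply: contraL etv => tS; apply: S_indep.
exists t, (fun J => (if s \in J then L else set0) :|: (if v \in J then [set v] else set0)).
split.
- rewrite subUset !sub1set !inE sS vS sL eqxx orbT //.
- by rewrite in_setU1 tL orbT.
- by move=> h; rewrite h in tS.
- by rewrite cards2; case: (_ != _); card_lia.
- move=> J JQ J0; split.
  + apply/subsetP => x xJ; rewrite inE; have := subsetP JQ _ xJ.
    by case/set2P => E; rewrite -E xJ ?E ?sL ?set11 ?orbT.
  + by rewrite subUset; apply/andP; split; case: ifP => _; rewrite ?sub0set ?subsetUr ?subsetUl.
  + apply/subsetP => x /setIP [+ xS]; rewrite in_setU => /orP []; case: ifP => [h|_]; rewrite ?in_set0 //.
      move=> xL; have : x \in [set s] by apply: (subsetP cl); rewrite inE xL.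
      by move/set1P => ->; rewrite in_setU1 h orbT.
    by move/set1P => ->; rewrite in_setU1 h orbT.
  + case: (boolP (s \in J)) => sJ; case: (boolP (v \in J)) => vJ.
    * have d : [disjoint L & [set v]] by rewrite disjoint_sym disjoints1.
      have c0 : 0 < cross e L [set v] by apply: cross_gt0 tL _ etv; rewrite set11.
      by rewrite arcsU // cardsU (disjoint_setI0 d) cards0 cards1; card_lia.
    * by rewrite setU0.
    * by rewrite set0U cards1; card_lia.
    * by rewrite setU0 cards0.
  + by move=> h; rewrite h in tS.
Qed.

Lemma leg_at_sub X (X' : {set T}) L s x : X' \subset X -> x \in X' -> leg_at X L s x -> leg_at X' L s x.
Proof.
move=> XX xX [a1 a2 a3 a4 a5 a6 a7 a8]; split=> //; first exact: disjointWr XX a3.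
by move=> y z yL zX; apply: a7 => //; apply: (subsetP XX).
Qed.

(* Twice the quantity |S| + |E| - |V|, where a pending leg counts as a vertex of [S]: extending
   legs leaves it unchanged, and closing a spider with m legs lowers it by at most 2m + 2. *)
Lemma strip X Q leg at_ : pending X Q leg at_ ->
  (forall U, U \subset X -> U != set0 -> arcs e U < 2 * #|U|) ->
  exists J ctr F col, spider_system e S D (X :|: legs Q leg) J ctr F col /\
    2 * #|S :&: X| + 2 * #|Q| + arcs e X + 6 * #|ctr @: J| <= 2 * #|X| + 6 * #|J|.
Proof.
have [n] := ubnP #|X|; elim: n X Q leg at_ => // n IH X Q leg at_ lt [pl pin] forest.
have [X0|[x0 x0X]] := set_0Vmem X.
  have Q0 : Q = set0.
    by apply/setP => s; rewrite inE; apply/negP => /pl [_]; rewrite X0 inE.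
  exists set0, id, (fun=> set0), xpredT; rewrite X0 Q0 /arcs cross0l imset0 setI0 !cards0.
  split=> //; split.
  - exact: sub0set.
  - by move=> s; rewrite inE.
  - by move=> a; rewrite (_ : [set _ in _ | _] = set0) ?cards0 //; apply/setP => s; rewrite !inE.
  - move=> b J'; rewrite (_ : [set _ in _ | _] = set0); last by apply/setP => s; rewrite !inE.
    rewrite subset0 => /eqP ->; split; rewrite ?sub0set // ?set0I ?sub0set ?cards0 //.
    by rewrite imset0 setI0.
  - by move=> b J' J'' _ _ _ x y; rewrite inE.
have Xn0 : X != set0 by apply/set0Pn; exists x0.
have [v vX dv] : exists2 v, v \in X & cross e [set v] X <= 1.
  apply/exists_inP; apply: contraT; rewrite negb_exists_in => /forall_inP h.
  have := forest _ (subxx _) Xn0; rewrite ltnNge => /negP [].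
  by apply: cross_geM => x /h; rewrite -ltnNge.
pose X' := X :\ v; pose Qv := [set s in Q | at_ s == v]; pose Q' := Q :\: Qv.
have X'X : X' \subset X by apply: subsetDl.
have Q'Q : Q' \subset Q by apply: subsetDl.
have QvQ : Qv \subset Q by apply/subsetP => s; rewrite inE => /andP [].
have cX := cardsD1 v X; rewrite vX in cX.
have cQ : #|Q| = #|Qv| + #|Q'| by rewrite -(cardsID Qv Q) (setIidPr QvQ).
have aX : arcs e X = arcs e X' + 2 * cross e [set v] X by rewrite (arcsD1 e_sym e_irr vX) cross1D1.
have cS : #|S :&: X| = (v \in S) + #|S :&: X'|.
  rewrite (cardsD1 v (S :&: X)) inE vX andbT; congr (_ + _).
  by apply: eq_card => x; rewrite !inE; case: (x == v); rewrite ?andbF.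
have ltX : #|X'| < n by rewrite /X'; card_lia.
have vX' : v \notin X' by rewrite !inE eqxx.
have forest' U : U \subset X' -> U != set0 -> arcs e U < 2 * #|U|.
  by move=> UX; apply: forest; apply: subset_trans UX X'X.
have pl' s : s \in Q' -> leg_at X' (leg s) s (at_ s).
  move=> /setDP [sQ sv]; apply: leg_at_sub (pl _ sQ) => //.
  have [_ h _ _ _ _ _ _] := pl _ sQ.
  by rewrite !inE h andbT; move: sv; rewrite !inE sQ.
have pend' : pending X' Q' leg at_.
  by split=> // s t sQ tQ; apply: pin; apply: (subsetP Q'Q).
have plv s : s \in Qv -> leg_at X (leg s) s v.
  by rewrite inE => /andP [sQ /eqP <-]; apply: pl.
have [p hp] : exists p, forall y, y \in X -> e v y -> y = p.
  rewrite cross1l in dv; have [z|[p pE]] := set_0Vmem [set y in X | e v y].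
    by exists v => y yX evy; have : y \in set0; [rewrite -z inE yX|rewrite inE].
  exists p => y yX evy; have /card_le1_eqP h := dv; by apply: h => //; rewrite inE yX.
(* A spider on v and the legs hanging from it meets the rest only through the edge from v to p. *)
have glue Z JZ a FZ : spider e S D Z JZ a FZ -> Z = v |: legs Qv leg ->
    2 * (v \in S) + 2 * #|Qv| + 8 <= 6 * #|JZ| + 2 ->
    exists J ctr F col, spider_system e S D (X :|: legs Q leg) J ctr F col /\
    2 * #|S :&: X| + 2 * #|Q| + arcs e X + 6 * #|ctr @: J| <= 2 * #|X| + 6 * #|J|.
  move=> sp EZ count.
  have [J0 [ctr0 [F0 [col0 [sys0 c0]]]]] := IH _ _ _ _ ltX pend' forest'.
  have ZP x : x \in Z -> x = v \/ exists2 s, s \in Qv & x \in leg s.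
    by rewrite EZ in_setU1 => /orP [/eqP|/legsP]; [left|right].
  have legX s x : s \in Q -> x \in leg s -> x \in X -> False.
    move=> sQ xs xX; have [_ _ dX _ _ _ _ _] := pl _ sQ.
    by move: dX; rewrite disjoints_subset => /subsetP /(_ _ xs); rewrite inE xX.
  have ne_of s t : s \in Qv -> t \in Q' -> s != t.
    by move=> sQ /setDP [_]; apply: contraNneq => <-.
  have dis : [disjoint X' :|: legs Q' leg & Z].
    rewrite -setI_eq0; apply/eqP/setP => x; rewrite in_setI in_set0; apply/negP => /andP [xY /ZP xZ].
    move: xY; rewrite in_setU => /orP [xX|/legsP [t tQ xt]]; case: xZ => [E|[s sQ xs]].
    - by rewrite E (negbTE vX') in xX.
    - by apply: (legX s x) => //; [apply: (subsetP QvQ)|apply: (subsetP X'X)].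
    - by apply: (legX t x) => //; [apply: (subsetP Q'Q)|rewrite E].
    - by have [/eqP] := pin _ _ (subsetP QvQ _ sQ) (subsetP Q'Q _ tQ) (ne_of _ _ sQ tQ) _ _ xs xt.
  have adj x y : x \in Z -> y \in X' :|: legs Q' leg -> e x y -> y = p.
    move=> /ZP xZ; rewrite in_setU => /orP [yX|/legsP [t tQ yt]] exy; case: xZ => [E|[s sQ xs]].
    - by apply: hp; rewrite ?(subsetP X'X) // -E.
    - have [_ _ _ _ _ _ h _] := plv _ sQ.
      by move: vX'; rewrite -(h _ _ xs (subsetP X'X _ yX) exy) yX.
    - have tQQ := subsetP Q'Q _ tQ; have [_ _ _ _ _ _ h _] := pl _ tQQ.
      have := h _ _ yt vX; rewrite e_sym -E exy => /(_ isT) E'.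
      by move: tQ; rewrite !inE -E' E eqxx tQQ.
    - by have [_ /negP] := pin _ _ (subsetP QvQ _ sQ) (subsetP Q'Q _ tQ) (ne_of _ _ sQ tQ) _ _ xs yt.
  have [ctr [F [col [sys c1]]]] := spider_glue e_sym sys0 sp dis adj.
  exists (J0 :|: JZ), ctr, F, col; split.
    apply: spider_system_sub sys; rewrite EZ !subUset sub1set !in_setU vX /=.
    rewrite (subset_trans X'X (subsetUl _ _)) /=.
    by rewrite !(subset_trans (legs_sub _ _) (subsetUr _ _)).
  have cJ : #|J0 :|: JZ| = #|J0| + #|JZ|.
    rewrite cardsU (_ : J0 :&: JZ = set0) ?cards0 ?subn0 //.
    apply/eqP; rewrite setI_eq0; apply: disjointWl (_ : J0 \subset X' :|: legs Q' leg) _.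
      by apply: subset_trans (sys_sub sys0) (subsetIr _ _).
    by apply: disjointWr dis; apply: subset_trans (spi_sub sp) (subsetIr _ _).
  (* The vertex [v] and its at most one edge balance, so the step costs at most
     [2 * (v \in S) + 2 * #|Qv|], and the new spider yields [6 * (#|JZ| - 1)]. The factor 6 is the
     least that covers [2 * m + 2] for all [m >= 2]. *)
  rewrite cJ cS cQ aX cX; rewrite /X' in c0 *; card_lia.
case: (leqP 2 #|Qv|) => [Qv2|Qv1].
  have sp := star_spider plv (fun s t sQ tQ => pin s t (subsetP QvQ _ sQ) (subsetP QvQ _ tQ)).
  by apply: glue sp _ _ => //; case: (v \in S); card_lia.
have [/andP [vS Qv0]|easy] := boolP ((v \in S) && (0 < #|Qv|)).
  have /cards1P [s Es] : #|Qv| == 1 by card_lia.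
  have sQv : s \in Qv by rewrite Es set11.
  have [t [F sp]] := path_spider (plv _ sQv) vS.
  apply: glue sp _ _; first by rewrite Es /legs big_set1.
  have ne : s != v.
    have [_ _ dX sL _ _ _ _] := plv _ sQv.
    by apply: contraTneq vX => <-; move: dX; rewrite disjoints_subset => /subsetP /(_ _ sL); rewrite inE.
  by rewrite cards2 ne vS Es cards1.
(* From here on [v] accounts for at most one leg: it is dropped, starts a leg of its own at [p], or
   prolongs by one vertex the leg that hangs from it. *)
have few : (v \in S) + #|Qv| <= 1 by move: easy Qv1; case: (v \in S) => /=; card_lia.
(* If [v] is isolated, the one leg that may be lost is paid for by the vertex removed. *)
case: (posnP (cross e [set v] X)) => [d0|d1].
  have [J [ctr [F [col [sys c0]]]]] := IH _ _ _ _ ltX pend' forest'.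
  exists J, ctr, F, col; split.
    apply: spider_system_sub sys; rewrite subUset (subset_trans X'X (subsetUl _ _)) /=.
    exact: subset_trans (legs_sub _ Q'Q) (subsetUr _ _).
  rewrite cS cQ aX cX d0; rewrite /X' in c0 *; card_lia.
have [evp pX] : e v p /\ p \in X'.
  move: d1; rewrite cross1l card_gt0 => /set0Pn [y]; rewrite inE => /andP [yX evy].
  rewrite -(hp _ yX evy) evy !inE yX andbT; split=> //.
  by apply: contraTneq evy => ->; rewrite e_irr.
have cd : cross e [set v] X = 1 by card_lia.
have v_adj z : z \in X' -> e v z -> z = p by move=> /(subsetP X'X); apply: hp.
have legv s : s \in Q -> v \notin leg s.
  move=> sQ; apply/negP => h; have [_ _ dX _ _ _ _ _] := pl _ sQ.
  by move: dX; rewrite disjoints_subset => /subsetP /(_ _ h); rewrite inE vX.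
have finish Q2 leg2 at2 : pending X' Q2 leg2 at2 -> X' :|: legs Q2 leg2 \subset X :|: legs Q leg ->
    (v \in S) + #|Q| <= #|Q2| ->
    exists J ctr F col, spider_system e S D (X :|: legs Q leg) J ctr F col /\
    2 * #|S :&: X| + 2 * #|Q| + arcs e X + 6 * #|ctr @: J| <= 2 * #|X| + 6 * #|J|.
  move=> pd sub cQ2.
  have [J [ctr [F [col [sys c0]]]]] := IH _ _ _ _ ltX pd forest'.
  exists J, ctr, F, col; split; first exact: spider_system_sub sys.
  rewrite cS aX cX cd; rewrite /X' in c0 *; card_lia.
have Qnv s : s \in Q -> s \notin Qv -> leg_at X' (leg s) s (at_ s).
  by move=> sQ sv; apply: pl'; rewrite inE sQ sv.
have [Qv0|[q qv]] := set_0Vmem Qv.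
  have [vS|vS] := boolP (v \in S); last first.
    apply: (finish Q leg at_) => //; [|exact: setSU|by rewrite (negbTE vS)].
    by split=> // s sQ; apply: Qnv; rewrite // Qv0 inE.
  have vQ : v \notin Q.
    by apply/negP => vQ; have [_ _ _ h _ _ _ _] := pl _ vQ; have := legv _ vQ; rewrite h.
  pose leg2 s := if s == v then [set v] else leg s.
  pose at2 s := if s == v then p else at_ s.
  have vleg s y : s \in Q -> y \in leg s -> v != y /\ ~~ e v y.
    move=> sQ ys; split; first by apply: contraNneq (legv _ sQ) => ->.
    have [_ _ _ _ _ _ h _] := pl _ sQ; apply/negP; rewrite e_sym => eyv.
    have : s \in Qv by rewrite inE sQ -(h _ _ ys vX eyv) eqxx.
    by rewrite Qv0 inE.
  apply: (finish (v |: Q) leg2 at2).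
  - split.
      move=> s; rewrite in_setU1 /leg2 /at2; case: eqVneq => [-> _|_ /= sQ]; last by apply: Qnv; rewrite // Qv0 inE.
      split=> //; rewrite ?set11 ?disjoints1 ?subsetIl ?cards1 //; first card_lia.
        by move=> y z /set1P ->; apply: v_adj.
      by exists v; rewrite ?set11.
    move=> s t; rewrite !in_setU1 /leg2.
    case: eqVneq => [->|_] /=; case: eqVneq => [->|_] //=.
    + by move=> _ tQ _ x y /set1P -> yt; apply: vleg yt.
    + by move=> sQ _ _ x y xs /set1P ->; rewrite eq_sym e_sym; apply: vleg xs.
    + exact: pin.
  - rewrite subUset (subset_trans X'X (subsetUl _ _)) /=; apply/subsetP => x /legsP [s].
    rewrite in_setU1 /leg2; case: eqVneq => [_ _ /set1P ->|_ /= sQ xs]; first by rewrite inE vX.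
    by rewrite inE; apply/orP; right; apply/legsP; exists s.
  - by rewrite cardsU1 vQ vS.
have c1 : 0 < #|Qv| by rewrite card_gt0; apply/set0Pn; exists q.
have vS : v \notin S by apply/negP => vS; move: few; rewrite vS; card_lia.
have Qvq s : s \in Qv -> s = q.
  have /card_le1_eqP h : #|Qv| <= 1 by card_lia.
  by move=> sv; apply: h.
have qQ := subsetP QvQ _ qv.
pose leg2 s := if s == q then v |: leg q else leg s.
pose at2 s := if s == q then p else at_ s.
have vleg s y : s \in Q -> s != q -> y \in leg s -> v != y /\ ~~ e v y.
  move=> sQ ne ys; split; first by apply: contraNneq (legv _ sQ) => ->.
  have [_ _ _ _ _ _ h _] := pl _ sQ; apply/negP; rewrite e_sym => eyv.
  by case/negP: ne; apply/eqP/Qvq; rewrite inE sQ -(h _ _ ys vX eyv) eqxx.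
apply: (finish Q leg2 at2).
- split.
    move=> s sQ; rewrite /leg2 /at2; case: eqVneq => [->|ne]; last first.
      by apply: Qnv => //; apply: contra ne => /Qvq ->.
    have [a1 a2 a3 a4 a5 a6 a7 [y yL eyv]] := plv _ qv; split=> //.
    + rewrite -setI_eq0; apply/eqP/setP => x; rewrite in_setI in_set0; apply/negP => /andP [].
      rewrite in_setU1 => /orP [/eqP ->|xq]; first by rewrite (negbTE vX').
      by move: a3; rewrite disjoints_subset => /subsetP /(_ _ xq); rewrite inE => /negP h /(subsetP X'X).
    + by rewrite in_setU1 a4 orbT.
    + rewrite setIUl subUset a5 andbT; apply/subsetP => x /setIP [/set1P -> vS'].
      by rewrite vS' in vS.
    + rewrite arcsU1 // ?legv // cardsU1 legv //.
      have : 0 < cross e [set v] (leg q) by apply: (@cross_gt0 _ _ _ _ v y); rewrite ?set11 // e_sym.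
      by card_lia.
    + move=> x z /setU1P [->|xq]; first exact: v_adj.
      move=> zX exz; have E := a7 _ _ xq (subsetP X'X _ zX) exz.
      by rewrite E (negbTE vX') in zX.
    + by exists v; rewrite ?setU11.
  move=> s t sQ tQ; rewrite /leg2; case: (eqVneq s q) => [Es|sq]; case: (eqVneq t q) => [Et|tq].
  + by rewrite Es Et eqxx.
  + by move=> ne x y /setU1P [->|xq] yt; [apply: vleg yt|apply: (pin q t) => //; rewrite -Es].
  + move=> ne x y xs /setU1P [->|yq]; last by apply: (pin s q) => //; rewrite -Et.
    by rewrite eq_sym e_sym; apply: vleg xs.
  + exact: pin.
- rewrite subUset (subset_trans X'X (subsetUl _ _)) /=; apply/subsetP => x /legsP [s sQ].
  rewrite /leg2; case: eqVneq => [_ /setU1P [->|xq]|_ xs]; first by rewrite inE vX.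
    by rewrite inE; apply/orP; right; apply/legsP; exists q.
  by rewrite inE; apply/orP; right; apply/legsP; exists s.
- by rewrite (negbTE vS).
Qed.

Lemma forest_spiders X : (forall U, U \subset X -> U != set0 -> arcs e U < 2 * #|U|) ->
  exists J ctr F col, spider_system e S D X J ctr F col /\
    2 * #|S :&: X| + arcs e X + 6 * #|ctr @: J| <= 2 * #|X| + 6 * #|J|.
Proof.
move=> forest; have [|J [ctr [F [col [sys c]]]]] := @strip X set0 (fun=> set0) id _ forest.
  by split=> s; rewrite inE.
exists J, ctr, F, col; split; first by rewrite /legs big_set0 setU0 in sys.
by rewrite cards0 in c; card_lia.
Qed.

End Strip.

(** * Selecting legs *)

Section Gain.
Variables (T : finType) (ctr : T -> T).
Implicit Types (A B J : {set T}).

(** The surplus [#|J| - #|ctr @: J|], written here without subtraction, is split between the two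
    colours since no spider has legs of both; one colour keeps at least half. *)
Lemma colour_class (col : T -> bool) J : (forall s, s \in J -> col (ctr s) = col s) ->
  exists b, #|J| + 2 * #|ctr @: [set s in J | col s == b]| <=
            2 * #|[set s in J | col s == b]| + #|ctr @: J|.
Proof.
move=> h; pose K b := [set s in J | col s == b].
have cJ : #|J| = #|K true| + #|K false|.
  rewrite -(cardsID [set s | col s] J); congr (_ + _); apply: eq_card => s; rewrite !inE.
    by rewrite eqb_id.
  by rewrite andbC; case: (col s).
have cC : #|ctr @: K true| + #|ctr @: K false| <= #|ctr @: J|.
  have d : [disjoint ctr @: K true & ctr @: K false].
    rewrite -setI_eq0; apply/eqP/setP => x; rewrite in_setI in_set0; apply/negP => /andP [].
    move=> /imsetP [s]; rewrite inE => /andP [sJ /eqP Es] -> /imsetP [t].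
    rewrite inE => /andP [tJ /eqP Et] E.
    by have := h _ sJ; rewrite E h // Es Et.
  have -> : #|ctr @: K true| + #|ctr @: K false| = #|ctr @: K true :|: ctr @: K false|.
    by rewrite cardsU (disjoint_setI0 d) cards0 subn0.
  apply/subset_leq_card; rewrite subUset; apply/andP; split; apply: imsetS;
    by apply/subsetP => s; rewrite inE => /andP [].
case: (leqP (#|J| + 2 * #|ctr @: K true|) (2 * #|K true| + #|ctr @: J|)) => [le|lt].
  by exists true.
exists false; rewrite -/(K false); card_lia.
Qed.

Lemma restrict_fibres J : exists2 J2 : {set T}, J2 \subset J &
  #|J| + #|ctr @: J2| <= #|J2| + #|ctr @: J| /\ 2 * #|ctr @: J2| <= #|J2|.
Proof.
pose J2 := [set s in J | 1 < #|[set t in J | ctr t == ctr s]|].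
have sJ : J2 \subset J by apply/subsetP => s; rewrite inE => /andP [].
exists J2 => //; split.
  have cJ := cardsID J2 J; rewrite (setIidPr sJ) in cJ.
  have inj : {in J :\: J2 &, injective ctr}.
    move=> s t /setDP [s1 s2] /setDP [t1 t2] E; move: s2; rewrite inE s1 -leqNgt /=.
    by move/card_le1_eqP; apply; rewrite inE ?s1 ?t1 E eqxx.
  have d : [disjoint ctr @: J2 & ctr @: (J :\: J2)].
    rewrite -setI_eq0; apply/eqP/setP => x; rewrite in_setI in_set0; apply/negP => /andP [].
    move=> /imsetP [s]; rewrite inE => /andP [s1 s2] -> /imsetP [t /setDP [t1 t2] E].
    by case/negP: t2; rewrite inE t1 -E s2.
  have : #|ctr @: J2 :|: ctr @: (J :\: J2)| <= #|ctr @: J|.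
    by apply/subset_leq_card; rewrite subUset !imsetS // subsetDl.
  rewrite cardsU (disjoint_setI0 d) cards0 (card_in_imset inj); card_lia.
rewrite mulnC -sum_nat_const -[#|J2|]sum1_card [leqRHS](partition_big ctr (mem (ctr @: J2))) /=; last first.
  by move=> s sJ2; apply/imsetP; exists s.
apply: leq_sum => x /imsetP [s]; rewrite inE => /andP [s1 s2] ->.
rewrite sum1_card; apply: leq_trans (s2) _; apply/subset_leq_card/subsetP => t.
rewrite inE => /andP [tJ /eqP E]; rewrite unfold_in /= E eqxx andbT.
by rewrite inE tJ E s2.
Qed.

End Gain.

Section Bits.
Variables (T : finType).
Implicit Types (A B J : {set T}).

(** Forcing the three conditions on a set while recording its memberships of [a], [b], [c] as three
    bits is injective; hence the factor 8. *)
Lemma card_separating (a b c : T) (P : pred T) : (P c -> c != a) -> (P c -> c != b) ->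
  2 ^ #|T| <= 8 * #|[set A : {set T} | [&& a \in A, b \in A & P c ==> (c \notin A)]]|.
Proof.
move=> ca cb; set G := [set A | _].
pose phi A := (if P c then (a |: (b |: A)) :\ c else a |: (b |: A), (a \in A, b \in A, c \in A)).
have inj : injective phi.
  move=> A B [E ea eb ec]; apply/setP => x.
  case: (eqVneq x a) => [->|xa] //; case: (eqVneq x b) => [->|xb] //.
  case: (eqVneq x c) => [->|xc] //.
  have /setP /(_ x) := E; case: (P c); rewrite !inE ?xc (negbTE xa) (negbTE xb) //.
have : #|phi @: [set: {set T}]| <= #|setX G [set: bool * bool * bool]|.
  apply/subset_leq_card/subsetP => _ /imsetP [A _ ->]; rewrite inE /= in_setT andbT inE.
  case: ifP => [pc|_] /=; rewrite !inE !eqxx ?orbT ?andbT //=.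
  by rewrite !(eq_sym _ c) ca // cb.
by rewrite card_imset // cardsX -cardsT -powersetT card_powerset !cardsT !card_prod card_bool mulnC.
Qed.

(* Averaging over all [A]: a leg, the representative leg of its spider and the centre all behave
   as wanted for at least one eighth of the sets. *)
Lemma bit_selection (ctr foot : T -> T) (S J : {set T}) :
  (forall s, s \in J -> ctr s \in S -> foot (ctr s) != foot s) ->
  exists A, let JA := [set s in J | (foot s \in A) && ((ctr s \in S) ==> (foot (ctr s) \notin A))] in
    #|J| + 8 * #|ctr @: JA| <= 8 * #|JA| + #|ctr @: J|.
Proof.
move=> sep.
pose keep A s := (foot s \in A) && ((ctr s \in S) ==> (foot (ctr s) \notin A)).
pose JA A := [set s in J | keep A s].
pose G A := [set s in nonrep ctr J | keep A s && keep A (rep ctr J s)].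
(* Every surviving spider has a kept leg outside [G A]: its representative if that is kept,
   otherwise any kept leg. *)
have gain A : #|ctr @: JA A| + #|G A| <= #|JA A|.
  have GJ : G A \subset JA A.
    by apply/subsetP => s; rewrite !inE => /andP [/andP [-> _] /andP [-> _]].
  rewrite -[#|JA A|](cardsID (G A)) (setIidPr GJ) addnC leq_add2l.
  apply: leq_trans (leq_imset_card ctr _); apply/subset_leq_card/subsetP => x /imsetP [s].
  rewrite inE => /andP [sJ ks] ->; have [rJ E] := repP ctr sJ.
  have [kr|kr] := boolP (keep A (rep ctr J s)).
    apply/imsetP; exists (rep ctr J s) => //; rewrite !inE rJ kr /= rep_idem // eqxx //.
  by apply/imsetP; exists s; rewrite // !inE sJ ks /= (negbTE kr) !andbF.
have cS : #|{: {set T}}| = 2 ^ #|T| by rewrite -(cardsT T) -card_powerset powersetT cardsT.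
have [A hA] : exists A, #|nonrep ctr J| <= 8 * #|G A|.
  apply/existsP; apply: contraT; rewrite negb_exists => /forallP lt.
  have [nr0|nr0] := posnP #|nonrep ctr J|; first by have := lt set0; rewrite nr0.
  have : \sum_(A : {set T}) 8 * #|G A| < \sum_(A : {set T}) #|nonrep ctr J|.
    have sub1 : \sum_(A : {set T}) 8 * #|G A| <= \sum_(A : {set T}) #|nonrep ctr J|.-1.
      by apply: leq_sum => A _; have := lt A; card_lia.
    apply: leq_ltn_trans sub1 _; rewrite !sum_nat_const.
    by rewrite cS ltn_pmul2l ?ltn_predL // expn_gt0.
  rewrite ltnNge => /negP []; rewrite -big_distrr /= sum_nat_const.
  have -> : \sum_(A : {set T}) #|G A| = \sum_(s in nonrep ctr J) 
     #|[set A : {set T} | keep A s && keep A (rep ctr J s)]|.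
    have cG A : #|G A| = \sum_(s in nonrep ctr J) (keep A s && keep A (rep ctr J s) : nat).
      rewrite -sum1_card [LHS]big_mkcond [RHS]big_mkcond /=; apply: eq_bigr => s _.
      by rewrite [s \in G A]inE; case: (s \in _) => //=; case: (_ && _).
    have cK s : #|[set A : {set T} | keep A s && keep A (rep ctr J s)]|
        = \sum_(A : {set T}) (keep A s && keep A (rep ctr J s) : nat).
      rewrite -sum1_card [LHS]big_mkcond /=; apply: eq_bigr => A _.
      by rewrite inE; case: (_ && _).
    by rewrite (eq_bigr _ (fun A _ => cG A)) exchange_big /=; apply: eq_bigr => s _; rewrite cK.
  rewrite big_distrr /= mulnC -sum_nat_const; apply: leq_sum => s.
  rewrite inE => /andP [sJ ne]; have [rJ E] := repP ctr sJ.
  rewrite cS.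
  pose P (x : T) := ctr s \in S.
  apply: leq_trans (@card_separating (foot s) (foot (rep ctr J s)) (foot (ctr s)) P _ _) _.
  - exact: sep.
  - by rewrite /P -E => h; apply: sep.
  rewrite leq_mul2l /=; apply/subset_leq_card/subsetP => A; rewrite !inE /keep E /P.
  by case/and3P => -> -> ->.
exists A; have := gain A; have := card_nonrep ctr J; rewrite /= -/(JA A); card_lia.
Qed.

End Bits.

(** * Pulling cycles back *)

Lemma card_fibres (A B : finType) (f : A -> B) (X : {set A}) (Y : {set B}) d :
  (forall a, a \in X -> f a \in Y) ->
  (forall b, b \in Y -> #|[set a in X | f a == b]| <= d) -> #|X| <= d * #|Y|.
Proof.
move=> fXY fib; rewrite mulnC -sum_nat_const -[#|X|]sum1_card.
rewrite (partition_big f (mem Y)) //=; apply: leq_sum => b bY.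
by rewrite sum1_card; apply: leq_trans (fib b bY); apply/eq_leq/eq_card => a; rewrite inE.
Qed.

(** * Cutting a weighted sequence into blocks *)

Section Blocks.
Variables (T : finType) (J : {set T}) (pos : T -> nat) (M : nat).
Hypothesis M0 : 0 < M.

Definition prefix_weight i := #|[set s in J | pos s < i]|.

(* The number of the block of position [i] when the weight is divided into portions of [M];
   position 0 is separated from the others so that a cyclic sequence is opened there. *)
Definition block i := prefix_weight i %/ M + (0 < i).
Definition cut i := block i < block i.+1.

Lemma prefix_weight_mono i j : i <= j -> prefix_weight i <= prefix_weight j.
Proof.
move=> le; apply/subset_leq_card/subsetP => s; rewrite !inE => /andP [-> h].
exact: leq_trans h le.
Qed.

Lemma block_mono i j : i <= j -> block i <= block j.
Proof.
move=> le; apply: leq_add; first exact/leq_div2r/prefix_weight_mono.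
by case: i j le => [|i] [|j].
Qed.

Lemma block_le i : block i <= #|J| %/ M + 1.
Proof.
apply: leq_add; last by case: (0 < i).
by apply/leq_div2r/subset_leq_card/subsetP => s; rewrite inE => /andP [].
Qed.

Lemma cut0 : cut 0.
Proof.
rewrite /cut /block /= [prefix_weight 0](_ : _ = 0) ?div0n ?addn1 //.
by apply: eq_card0 => s; rewrite inE ltn0 andbF.
Qed.

Lemma cut_inj i j : cut i -> cut j -> block i = block j -> i = j.
Proof.
move=> ci cj E; case: (ltngtP i j) => // lt.
  by have := leq_trans ci (block_mono lt); rewrite E ltnn.
by have := leq_trans cj (block_mono lt); rewrite E ltnn.
Qed.

Lemma not_cut i : ~~ cut i -> block i.+1 = block i.
Proof. by rewrite /cut -leqNgt => le; apply/eqP; rewrite eqn_leq le block_mono. Qed.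

(** Since the last position of the block is not a cut, the weights before its first and after its
    last position have the same quotient by [M], so they differ by less than [M]. In particular a
    single position of weight [M] or more is always a cut. *)
Lemma block_size j : #|[set s in J | ~~ cut (pos s) && (block (pos s) == j)]| <= M.
Proof.
set X := [set s in J | _].
have [->|[s0 s0X]] := set_0Vmem X; first by rewrite cards0.
case: (arg_minnP pos s0X) => a aX amin; case: (arg_maxnP pos s0X) => b bX bmax.
have XP s : s \in X -> [/\ s \in J, ~~ cut (pos s) & block (pos s) = j].
  by rewrite inE => /and3P [h1 h2 /eqP h3].
have [_ ca ba] := XP _ aX; have [_ cb bb] := XP _ bX.
(* As position 0 is a cut, the summand [0 < i] of [block] is 1 at both ends and only the quotients
   remain. *)
have pa : 0 < pos a by rewrite lt0n; apply: contraNneq ca => ->; exact: cut0.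
have E : prefix_weight (pos b).+1 %/ M = prefix_weight (pos a) %/ M.
  have := not_cut cb; rewrite bb -ba /block pa /=; lia.
have sub : [set s in J | pos s < pos a] :|: X \subset [set s in J | pos s < (pos b).+1].
  apply/subsetP => s /setUP [|sX].
    rewrite !inE => /andP [-> lt] /=; rewrite ltnS.
    by apply: leq_trans (ltnW lt) (amin _ bX).
  by have [sJ _ _] := XP _ sX; rewrite inE sJ ltnS; apply: bmax.
have d : [disjoint [set s in J | pos s < pos a] & X].
  rewrite -setI_eq0; apply/eqP/setP => s; rewrite in_setI in_set0; apply/negP => /andP [].
  by rewrite inE => /andP [_ lt] /amin; rewrite leqNgt lt.
have := subset_leq_card sub; rewrite cardsU (disjoint_setI0 d) cards0 subn0.
rewrite -/(prefix_weight _) -/(prefix_weight _).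
have := divn_eq (prefix_weight (pos b).+1) M; have := divn_eq (prefix_weight (pos a)) M.
rewrite E; have := ltn_pmod (prefix_weight (pos b).+1) M0.
move: (_ %/ M * M) => u; lia.
Qed.

End Blocks.

(** * Independent rich sets from spiders and the cycle *)

Section Independent.
Variables (T : finType) (e : rel T) (c : seq T) (D : nat).
Hypothesis e_sym : symmetric e.
Hypothesis e_irr : irreflexive e.
Hypothesis girth : girth_ge e 11.
Hypothesis c_short : shortest_cycle e c.
Hypothesis degD : forall x, #|[set y | e x y]| <= D.
Implicit Types (G : {set T}).

Local Notation N := (nbhd_out e c).
Local Notation R := (rest e c).
Local Notation S := (attached e c).
Local Notation foot := (foot e c).
Local Notation base := (base e c).

Variables (J0 : {set T}) (ctr : T -> T) (F : {set T} -> {set T}) (col : T -> bool) (b : bool).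
Hypothesis sys : spider_system e S D R J0 ctr F col.
Local Notation K0 := [set s in J0 | col s == b].

Lemma sysS s : s \in K0 -> s \in S.
Proof. by rewrite inE => /andP [/(subsetP (sys_sub sys))]; rewrite inE => /andP []. Qed.

Lemma footN s : s \in K0 -> foot s \in N /\ e s (foot s).
Proof. by move/sysS => sS; apply: footP. Qed.

Lemma sys_rest G x : G \subset K0 -> x \in F G -> x \in R.
Proof. by move=> GK xF; have [_ /subsetP /(_ _ xF) + _ _ _] := sys_part sys GK; rewrite inE => /andP []. Qed.

Lemma sys_nbhd G x n : G \subset K0 -> x \in F G -> n \in N -> e x n ->
  foot x = n /\ (x \in G \/ exists2 s, s \in G & x = ctr s /\ x \in S).
Proof.
move=> GK xF nN exn; have [xS fx] := attachedP e_sym girth c_short (sys_rest GK xF) nN exn.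
split=> //; have [_ _ /subsetP /(_ x) h _ _] := sys_part sys GK.
by move: h; rewrite in_setI xF xS => /(_ isT) /setUP [|/imsetP [s sG E]]; [left|right; exists s].
Qed.

Lemma foot_fibre (G : {set T}) n : G \subset K0 -> #|[set s in G | foot s == n]| <= D.
Proof.
move=> GK; apply: leq_trans (degD n); apply/subset_leq_card/subsetP => s; rewrite !inE.
by move=> /andP [/(subsetP GK) /footN [_ es] /eqP <-]; rewrite e_sym.
Qed.

Lemma rest_neq_nbhd x n : x \in R -> n \in N -> x != n.
Proof. by move=> /restP [_ xN] nN; apply: contraNneq xN => ->. Qed.

(** If the centre shares the foot of the leg, the leg, the centre and that foot span a cycle.
    Different feet give independent sets, so fewer than [k] feet occur, each serving at most [D]
    legs. *)
Lemma local_cycles k : Ok_free e k ->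
  #|[set s in K0 | (ctr s \in S) && (foot (ctr s) == foot s)]| <= k * D.
Proof.
set B := [set s in K0 | _] => ok; rewrite leqNgt; apply/negP => lt.
have BP s : s \in B -> [/\ s \in K0, ctr s \in S & foot (ctr s) = foot s].
  by rewrite [s \in B]in_set => /and3P [h1 h2 /eqP].
have BK : B \subset K0 by apply/subsetP => s /BP [].
have kB : k <= #|foot @: B|.
  have : #|B| <= D * #|foot @: B|.
    apply: (card_fibres (f := foot)) => [s sB|n _]; first exact: imset_f.
    exact: foot_fibre.
  move=> le; rewrite leqNgt; apply/negP => lt'.
  have D0 : 0 < D by rewrite lt0n; apply/eqP => D0; move: lt le; rewrite D0 mul0n; case: #|B|.
  by have := leq_trans lt le; rewrite mulnC ltn_pmul2l // ltnNge (ltnW lt').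
have [f [fB finj]] : exists f : 'I_k -> T, (forall i, f i \in B) /\ injective (fun i => foot (f i)).
  have h i : exists s, (s \in B) && (foot s == enum_val (widen_ord kB i)).
    by have /imsetP [s sB ->] := enum_valP (widen_ord kB i); exists s; rewrite sB /=.
  have /fin_all_exists [f hf] := h; exists f; split=> [i|i j].
    by have /andP [] := hf i.
  have /andP [_ /eqP ->] := hf i; have /andP [_ /eqP ->] := hf j.
  by move/enum_val_inj => /(congr1 val) /= /val_inj.
have FB i : [set f i] \subset K0 by rewrite sub1set; have [] := BP _ (fB i).
pose X i := foot (f i) |: F [set f i].
apply: (@not_Ok_free _ _ e_sym e_irr k X _ _ ok) => [i|i j ne].
  have [sK cS cf] := BP _ (fB i); have [fN ef] := footN sK.
  have [p1 p2 p3 p4 p5] := sys_part sys (FB i).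
  have nF : foot (f i) \notin F [set f i].
    by apply/negP => /(sys_rest (FB i)) h; have := rest_neq_nbhd h fN; rewrite eqxx.
  rewrite /rich -card_gt0 cardsU1 nF /= arcsU1 //.
  have two : 2 <= cross e [set foot (f i)] (F [set f i]).
    have sJ : f i \in J0 by move: sK; rewrite inE => /andP [].
    have [_ _ /(_ cS) ne] := sys_ctr sys sJ.
    rewrite cross1l; apply: leq_trans (_ : #|[set ctr (f i); f i]| <= _); first by rewrite cards2 ne.
    apply/subset_leq_card/subsetP => x /set2P [->|->]; rewrite !inE.
      rewrite e_sym -cf; have [_ ->] := footP cS; rewrite andbT.
      by apply: (subsetP p5); rewrite inE cS imset_set1 set11.
    by rewrite e_sym ef (subsetP p1) // set11.
  move: p4; rewrite imset_set1 cards1; move: two; card_lia.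
have nf : foot (f i) != foot (f j) by apply: contraNneq ne => /finj ->.
have [iK iS iF] := BP _ (fB i); have [jK jS jF] := BP _ (fB j).
have [iN ei] := footN iK; have [jN ej] := footN jK.
(* The vertices of [S] in [F [set f i']] are [f i'] and possibly its centre, and both have the foot
   of [f i']. *)
have side i' j' x : foot (f i') != foot (f j') -> x \in F [set f i'] -> ~~ e x (foot (f j')).
  move=> ne' xF; have [sK _ sF] := BP _ (fB i'); have [tN _] := footN (subsetP BK _ (fB j')).
  apply/negP => ex; have [E [/set1P h|[t /set1P h [h' _]]]] := sys_nbhd (FB i') xF tN ex.
    by rewrite -E h eqxx in ne'.
  by rewrite -E h' h sF eqxx in ne'.
move=> x y /setU1P [->|xF] /setU1P [->|yF].
- by split=> //; apply: (nbhd_indep e_sym e_irr girth c_short) iN jN.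
- split; first by rewrite eq_sym; apply: rest_neq_nbhd => //; apply: sys_rest yF.
  by rewrite e_sym; apply: side yF; rewrite eq_sym.
- by split; [apply: rest_neq_nbhd => //; apply: sys_rest xF|apply: side xF].
- apply: (sys_indep sys (FB i) (FB j)) xF yF => s t /set1P -> /set1P ->.
  by apply: contraNneq nf => E; rewrite -iF -jF E.
Qed.

Section CycleSide.
Variables (J A : {set T}) (M : nat).
Hypothesis JK : J \subset K0.
Hypothesis JA : forall s, s \in J -> foot s \in A /\ (ctr s \in S -> foot (ctr s) \notin A).
Hypothesis M0 : 0 < M.
Hypothesis DM : D <= M.

Definition cpos s := index (base (foot s)) c.
Local Notation cutc := (cut J cpos M).
Local Notation blockc := (block J cpos M).
Local Notation nblocks := (#|J| %/ M + 1).

(* The part of the cycle side that [s] is attached to: a segment of [c], or its own foot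
   if that foot hangs from a vertex at which [c] is cut. *)
Definition part s : T + 'I_nblocks.+1 :=
  if cutc (cpos s) then inl (foot s) else inr (inord (blockc (cpos s))).

Lemma inord_block i j : inord (blockc i) = inord (blockc j) :> 'I_nblocks.+1 -> blockc i = blockc j.
Proof. by move/(congr1 val); rewrite /= !inordK // ltnS block_le. Qed.

Lemma part_foot s t : foot s = foot t -> part s = part t.
Proof. by rewrite /part /cpos => ->. Qed.

Lemma part_fibre a : #|[set s in J | part s == a]| <= M.
Proof.
case: a => [n|j].
  apply: leq_trans DM; apply: leq_trans (foot_fibre n JK); apply/subset_leq_card/subsetP => s.
  rewrite !inE => /andP [-> /eqP]; rewrite /part; case: ifP => // _ [->]; exact: eqxx.
apply: leq_trans (block_size J cpos M0 j); apply/subset_leq_card/subsetP => s.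
rewrite !inE => /andP [-> /eqP]; rewrite /part; case: ifP => // nc [<-] /=.
by rewrite inordK ?eqxx // ltnS block_le.
Qed.

(** The first term counts feet at cut vertices: at most [D] at each, one cut per block number, and
    none with the last number because the number grows after a cut. The second counts the possible
    block numbers. *)
Lemma card_parts : #|part @: J| <= D * nblocks + nblocks.+1.
Proof.
pose N1 := [set n in foot @: J | cutc (index (base n) c)].
have cN1 : #|N1| <= D * nblocks.
  pose g n : 'I_nblocks.+1 := inord (blockc (index (base n) c)).
  have : #|N1| <= D * #|[set i : 'I_nblocks.+1 | i < nblocks]|.
    apply: (card_fibres (f := g)) => [n|i _].
      rewrite !inE => /andP [_ ct]; rewrite inordK ?ltnS ?block_le //.
      exact: leq_trans ct (block_le _ _ _ _).
    have [->|[n nX]] := set_0Vmem [set n in N1 | g n == i]; first by rewrite cards0.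
    move: nX; rewrite inE => /andP [nN1 /eqP Eg].
    have baseN m : m \in N1 -> m \in N /\ base m \in c.
      rewrite inE => /andP [/imsetP [s /(subsetP JK) /footN [fN _] ->] _].
      by split=> //; have [] := baseP fN.
    apply: leq_trans (degD (base n)); apply/subset_leq_card/subsetP => m.
    rewrite inE => /andP [mN1 /eqP Em]; rewrite inE.
    have [mN mc] := baseN _ mN1; have [nN nc] := baseN _ nN1.
    have : index (base m) c = index (base n) c.
      apply: (@cut_inj _ J cpos M).
      - by move: mN1; rewrite inE => /andP [].
      - by move: nN1; rewrite inE => /andP [].
      - by apply: inord_block; rewrite -/(g m) -/(g n) Em Eg.
    move/(index_inj (base n) mc nc) => <-; rewrite e_sym.
    by have [] := baseP mN.
  suff -> : #|[set i : 'I_nblocks.+1 | i < nblocks]| = nblocks by [].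
  have := cardsC [set i : 'I_nblocks.+1 | i < nblocks]; rewrite card_ord.
  have -> : ~: [set i : 'I_nblocks.+1 | i < nblocks] = [set ord_max].
    by apply/setP => i; rewrite !inE -leqNgt -val_eqE /= eqn_leq (leq_ord i).
  by rewrite cards1; lia.
have : part @: J \subset (inl @: N1) :|: (inr @: [set: 'I_nblocks.+1]).
  apply/subsetP => _ /imsetP [s sJ ->]; rewrite inE /part; case: ifP => ct.
    by apply/orP; left; apply: imset_f; rewrite inE ct imset_f.
  by apply/orP; right; apply: imset_f; rewrite inE.
move/subset_leq_card => h; apply: leq_trans h _; rewrite cardsU.
have h1 : #|[set inl x | x in N1] : {set T + 'I_nblocks.+1}| <= #|N1| by apply: leq_imset_card.
have h2 : #|[set inr x | x in [set: 'I_nblocks.+1]] : {set T + 'I_nblocks.+1}| <= nblocks.+1.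
  by apply: leq_trans (leq_imset_card _ _) _; rewrite cardsT card_ord.
apply: leq_trans (leq_subr _ _) _; apply: leq_add => //.
exact: leq_trans h1 cN1.
Qed.

Definition segment G := [set x in c | ~~ cutc (index x c) &&
  ((inr (inord (blockc (index x c))) : T + 'I_nblocks.+1) \in part @: G)].

Definition hull G := F G :|: (foot @: G :|: segment G).

Lemma segmentP G x : x \in segment G ->
  [/\ x \in c, ~~ cutc (index x c) & exists2 s, s \in G & part s = inr (inord (blockc (index x c)))].
Proof. by rewrite inE => /and3P [h1 h2 /imsetP [s sG E]]; split=> //; exists s. Qed.

(** Each vertex except the last of its block is joined to its successor, with the index as rank; so
    at most one vertex per block is left without a parent. *)
Lemma segment_arcs G :
  2 * #|segment G| <= arcs e (segment G) +
    2 * #|[set j : 'I_nblocks.+1 | (inr j : T + 'I_nblocks.+1) \in part @: G]|.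
Proof.
set C := segment G; set B := [set j | _].
have [[c3 cu _] _] := c_short.
pose par x := nth x c (index x c).+1.
pose Y := [set x in C | ((index x c).+1 < size c) && (par x \in C)].
have YC : Y \subset C by apply/subsetP => x; rewrite inE => /andP [].
have h1 : 2 * #|Y| <= arcs e C.
  apply: (arcs_parent e_sym (par := par) (rk := fun x => index x c)) => // x.
  rewrite inE => /and3P [xC lt pC]; split=> //.
    rewrite -{1}(nth_index x (_ : x \in c)); last by have [] := segmentP xC.
    exact: (cycle_nth c_short).
  by rewrite /par index_uniq.
suff h2 : #|C :\: Y| <= #|B|.
  have h3 := cardsID Y C; rewrite (setIidPr YC) in h3.
  by rewrite -h3 mulnDr; apply: leq_add => //; rewrite leq_mul2l h2.
pose g x : 'I_nblocks.+1 := inord (blockc (index x c)).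
have ginj : {in C :\: Y &, injective g}.
  suff inj x y : x \in C :\: Y -> y \in C :\: Y -> g x = g y -> index x c < index y c -> False.
    move=> x y xC yC E; have [xc _ _] := segmentP (subsetP (subsetDl _ _) _ xC).
    have [yc _ _] := segmentP (subsetP (subsetDl _ _) _ yC).
    case: (ltngtP (index x c) (index y c)) => [lt|lt|].
    - by case: (inj x y).
    - by case: (inj y x).
    - exact: index_inj.
  move=> /setDP [xC xY] /setDP [yC _] /inord_block E lt.
  have [xc nx [s sG Es]] := segmentP xC; have [yc ny _] := segmentP yC.
  have yl : index y c < size c by rewrite index_mem.
  have x1 : (index x c).+1 < size c by apply: leq_ltn_trans lt yl.
  have ip : index (par x) c = (index x c).+1 by rewrite /par index_uniq.
  have Ex := not_cut nx.
  have pC : par x \notin C by apply: contra xY => pC; rewrite inE xC x1.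
  have cp : cutc (index x c).+1.
    apply: contraR pC => ncp; rewrite inE ip ncp Ex mem_nth //=.
    by apply/imsetP; exists s.
  move: lt; rewrite leq_eqVlt => /orP [/eqP E2|lt2].
    by rewrite E2 (negbTE ny) in cp.
  have := leq_trans cp (block_mono J cpos M lt2).
  by rewrite Ex E ltnn.
rewrite -(card_in_imset ginj); apply/subset_leq_card/subsetP => _ /imsetP [x /setDP [xC _] ->].
by rewrite inE; have [_ _ [s sG Es]] := segmentP xC; apply/imsetP; exists s.
Qed.

(** Euler count: [F G] lacks at most [#|ctr @: G|] edges and the segments lack at most one per
    block. A foot is paid for by its edge to a segment or, at a cut vertex, is a part of its own.
    The deficit is at most [#|ctr @: G| + #|part @: G|], and the edges from leg ends to feet, one
    per element of [G], cover it. *)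
Lemma hull_rich G : G \subset J -> cyclic ctr part G -> rich e (hull G).
Proof.
move=> GJ /andP [G0 cyc]; have GK := subset_trans GJ JK.
have [p1 p2 p3 p4 p5] := sys_part sys GK.
set C := segment G; set Nf := foot @: G.
have NfN n : n \in Nf -> n \in N.
  by move=> /imsetP [s /(subsetP GK) /footN [fN _] ->].
rewrite /rich /hull -/C -/Nf; apply/andP; split.
  case/set0Pn: G0 => s sG; apply/set0Pn; exists s.
  by rewrite inE (subsetP p1).
have d1 : [disjoint Nf & C].
  rewrite -setI_eq0; apply/eqP/setP => x; rewrite in_setI in_set0; apply/negP => /andP [].
  by move=> /NfN /nbhdP [xc _] /segmentP []; rewrite (negbTE xc).
have d2 : [disjoint F G & Nf :|: C].
  rewrite -setI_eq0; apply/eqP/setP => x; rewrite in_setI in_set0; apply/negP => /andP [].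
  move=> /(sys_rest GK) xR /setUP [/NfN xN|/segmentP [xc _ _]].
    by have := rest_neq_nbhd xR xN; rewrite eqxx.
  by have [] := restP xR; rewrite xc.
pose N1 := [set n in Nf | cutc (index (base n) c)].
pose N2 := [set n in Nf | ~~ cutc (index (base n) c)].
pose B := [set j : 'I_nblocks.+1 | (inr j : T + 'I_nblocks.+1) \in part @: G].
have cN : #|Nf| = #|N1| + #|N2|.
  rewrite -(cardsID N1 Nf); congr (_ + _); apply: eq_card => n; rewrite !inE.
    by rewrite andbA andbb.
  by case: (n \in Nf); rewrite ?andbF //= andbT.
have c1 : #|G| <= cross e (F G) (Nf :|: C).
  apply: leq_trans (cross_le e p1 (subsetUl Nf C)).
  rewrite -[#|G|]mul1n; apply: cross_geM => s sG.
  have [_ es] := footN (subsetP GK _ sG).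
  by apply: cross_gt0 es; rewrite ?set11 ?imset_f.
have c2 : #|N2| <= cross e Nf C.
  apply: leq_trans (cross_le e (_ : N2 \subset Nf) (subxx C)); last first.
    by apply/subsetP => n; rewrite inE => /andP [].
  rewrite -[#|N2|]mul1n; apply: cross_geM => n; rewrite inE => /andP [nN nc].
  have [bc eb] := baseP (NfN _ nN); apply: cross_gt0 eb; rewrite ?set11 //.
  rewrite inE bc nc /=; case/imsetP: nN nc => s sG -> nc; apply/imsetP; exists s => //.
  by rewrite /part /cpos (negbTE nc).
have c3 : #|N1| + #|B| <= #|part @: G|.
  have <- : #|(inl @: N1 : {set T + 'I_nblocks.+1}) :|: inr @: B| = #|N1| + #|B|.
    rewrite cardsU (_ : _ :&: _ = set0).
      by rewrite cards0 subn0 !card_imset //; [move=> ? ? []|move=> ? ? []].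
    by apply/setP => x; rewrite in_setI in_set0; apply/negP => /andP [/imsetP [? _ ->] /imsetP []].
  apply/subset_leq_card; rewrite subUset; apply/andP; split; apply/subsetP => x /imsetP [y].
    rewrite inE => /andP [/imsetP [s sG ->] ct] ->; apply/imsetP; exists s => //.
    by rewrite /part /cpos ct.
  by rewrite inE => yG ->.
have c4 := segment_arcs G; rewrite -/C -/B in c4.
rewrite !arcsU // !cardsU (disjoint_setI0 d1) (disjoint_setI0 d2) !cards0.
move: cyc p4 cN c1 c2 c3 c4; clear.
move: #|ctr @: G| #|part @: G| #|G| #|F G| (arcs e (F G)) #|Nf| #|N1| #|N2| #|B| #|C| (arcs e C)
  (cross e Nf C) (cross e (F G) _) (arcs e Nf); lia.
Qed.

Lemma hull_indep G (G' : {set T}) : G \subset J -> G' \subset J ->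
  (forall s t, s \in G -> t \in G' -> ctr s != ctr t /\ part s != part t) ->
  indep e (hull G) (hull G').
Proof.
move=> GJ GJ' sep; have GK := subset_trans GJ JK; have GK' := subset_trans GJ' JK.
have footG (G1 : {set T}) (n : T) : G1 \subset K0 -> n \in foot @: G1 -> n \in N.
  by move=> GK1 /imsetP [s /(subsetP GK1) /footN [fN _] ->].
have FN (G1 G2 : {set T}) (x n : T) : G1 \subset J -> G2 \subset J ->
    (forall s t, s \in G1 -> t \in G2 -> part s != part t) ->
    x \in F G1 -> n \in foot @: G2 -> x != n /\ ~~ e x n.
  move=> J1 J2 sp xF nF; have K1 := subset_trans J1 JK; have K2 := subset_trans J2 JK.
  have nN := footG _ _ K2 nF; split; first by apply: rest_neq_nbhd nN; apply: sys_rest xF.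
  apply/negP => exn; have [E h] := sys_nbhd K1 xF nN exn.
  case/imsetP: nF => t tG En; case: h => [xG|[s sG [Ex xS]]].
    by have := sp _ _ xG tG; rewrite (part_foot (s := x) (t := t)) ?eqxx // E.
  (* This is where [A] is used: the feet in a hull lie in [A], whereas the foot of a centre in [S]
     does not. *)
  have [_ h] := JA (subsetP J1 _ sG); have [h' _] := JA (subsetP J2 _ tG).
  by move: (h); rewrite -Ex xS E En h' => /(_ isT).
have FC (G1 G2 : {set T}) (x y : T) : G1 \subset J -> x \in F G1 -> y \in segment G2 -> x != y /\ ~~ e x y.
  move=> J1 xF /segmentP [yc _ _]; have xR := sys_rest (subset_trans J1 JK) xF.
  split; last exact: rest_cycle_nonadj xR yc.
  by have [xc _] := restP xR; apply: contraNneq xc => ->.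
have NC (G1 G2 : {set T}) (n y : T) : G1 \subset J -> (forall s t, s \in G1 -> t \in G2 -> part s != part t) ->
    n \in foot @: G1 -> y \in segment G2 -> n != y /\ ~~ e n y.
  move=> J1 sp nF /segmentP [yc ny [t tG Et]]; have nN := footG _ _ (subset_trans J1 JK) nF.
  split; first by have [nc _] := nbhdP nN; apply: contraNneq nc => ->.
  apply/negP => eny; have Ey := base_unique e_sym girth c_short nN yc eny.
  case/imsetP: nF => s sG En; have := sp _ _ sG tG.
  by rewrite Et /part /cpos -En -Ey (negbTE ny) eqxx.
have CC (G1 G2 : {set T}) (x y : T) : (forall s t, s \in G1 -> t \in G2 -> part s != part t) ->
    x \in segment G1 -> y \in segment G2 -> index x c <= index y c -> x != y /\ ~~ e x y.
  move=> sp /segmentP [xc nx [s sG Es]] /segmentP [yc ny [t tG Et]] le.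
  have st := sp _ _ sG tG.
  have ne : x != y by apply: contraNneq st => E; rewrite Es Et E.
  split=> //; apply/negP => exy.
  have lt : index x c < index y c.
    by rewrite ltn_neqAle le andbT; apply: contra ne => /eqP /(index_inj x xc yc) ->.
  case: (chord e_sym c_short xc yc lt exy) => [E|[E _]].
    by case/negP: st; rewrite Es Et E (not_cut nx).
  (* The closing edge of [c] starts at position 0, which is always a cut and hence in no segment. *)
  by move: nx; rewrite E cut0.
have sp s t : s \in G -> t \in G' -> part s != part t by move=> sG tG; have [] := sep _ _ sG tG.
have sp' s t : s \in G' -> t \in G -> part s != part t by move=> sG tG; rewrite eq_sym sp.
have flip x y : y != x /\ ~~ e y x -> x != y /\ ~~ e x y by rewrite eq_sym e_sym.
move=> x y; rewrite /hull !in_setU => /or3P [xF|xN|xC] /or3P [yF|yN|yC].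
- by apply: (sys_indep sys GK GK') xF yF => s t sG tG; have [] := sep _ _ sG tG.
- exact: FN GJ GJ' sp xF yN.
- exact: FC GJ xF yC.
- exact/flip/(FN _ _ _ _ GJ' GJ sp' yF xN).
- split; last by apply: (nbhd_indep e_sym e_irr girth c_short); [apply: footG GK xN|apply: footG GK' yN].
  case/imsetP: xN => s sG ->; case/imsetP: yN => t tG ->.
  by apply: contraNneq (sp _ _ sG tG) => E; rewrite (part_foot E).
- exact: NC GJ sp xN yC.
- exact/flip/(FC _ _ _ _ GJ' yF xC).
- exact/flip/(NC _ _ _ _ GJ' sp' yN xC).
- case: (leqP (index x c) (index y c)) => [le|lt]; first exact: CC sp xC yC le.
  exact/flip/(CC _ _ _ _ sp' yC xC (ltnW lt)).
Qed.

Lemma few_legs k : Ok_free e k ->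
  #|J| <= #|ctr @: J| + 3 * k * (D * nblocks + nblocks.+1) + 4 * k * M.
Proof.
move=> ok; rewrite leqNgt; apply/negP => lt.
have zf a : #|[set s in J | ctr s == a]| <= M.
  apply: leq_trans DM; apply: leq_trans (sys_fibre sys a).
  apply/subset_leq_card/subsetP => s; rewrite !inE => /andP [/(subsetP JK)].
  by rewrite inE => /andP [-> _] ->.
have count : #|ctr @: J| + 3 * k * #|part @: J| + 4 * k * M < #|J|.
  by apply: leq_ltn_trans lt; rewrite leq_add2r leq_add2l leq_mul2l card_parts orbT.
have [G [hG dG]] := cyclic_family zf part_fibre count.
apply: (@not_Ok_free _ _ e_sym e_irr k (fun i => hull (G i)) _ _ ok) => [i|i j ne].
  by have [GJ cyc] := hG i; apply: hull_rich.
have [Gi _] := hG i; have [Gj _] := hG j.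
by apply: hull_indep => // s t sG tG; apply: dG ne _ _ sG tG.
Qed.

End CycleSide.
End Independent.

(** The losses multiplied: 6 from stripping, 2 from the colours, an additive [k] for the legs that
    share the foot of their centre, 8 from the choice of [A], and [12 * k + 192 * k * k] for the
    final surplus, all in units of [D]. *)
Definition rank_const k := 12 * (8 * (12 * k + 192 * k * k) + k).

Lemma rank_le_max_degree (T : finType) (e : rel T) (c : seq T) k D : 0 < k ->
  simple_graph e -> connected_graph e -> Ok_free e k -> girth_ge e 11 ->
  shortest_cycle e c -> induced_forest e (rest e c) ->
  2 <= D -> (forall x, deg e x <= D) ->
  2 * n_edges e + 2 * n_components e <= 2 * #|T| + (rank_const k).+1 * D.
Proof.
move=> k0 [e_sym e_irr] conn ok girth c_short forest D2 degD.
have S_indep (s s' : T) : s \in attached e c -> s' \in attached e c -> ~~ e s s'.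
  move=> sS sS'; have [nN es] := footP sS; have [nN' es'] := footP sS'.
  have sR t : t \in attached e c -> t \in rest e c by rewrite inE => /andP [].
  exact: (attached_indep e_sym e_irr girth c_short (sR _ sS) (sR _ sS') nN nN' es es').
have sparse (U : {set T}) : U \subset rest e c -> U != set0 -> arcs e U < 2 * #|U|.
  move=> UR U0; rewrite ltnNge; apply/negP => le.
  have [|d [dc da]] := @rich_cycle _ _ e_sym e_irr U; first by rewrite /rich U0.
  by apply: forest; exists d; split=> //; apply: sub_all da => x; apply: (subsetP UR).
have [J [ctr [F [col [sys h0]]]]] := forest_spiders e_sym e_irr S_indep D2 degD sparse.
have SR : attached e c :&: rest e c = attached e c.
  by apply/setIidPl/subsetP => s; rewrite inE => /andP [].
rewrite SR in h0.
have [b h1] : exists b, #|J| + 2 * #|ctr @: [set s in J | col s == b]| <=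
            2 * #|[set s in J | col s == b]| + #|ctr @: J|.
  by apply: colour_class => s /(sys_ctr sys) [].
set J1 := [set s in J | col s == b] in h1.
have bad := local_cycles e_sym e_irr girth c_short degD b sys ok.
rewrite -/J1 in bad; set B := [set s in J1 | _] in bad.
pose J2 := J1 :\: B.
have c2 : #|J1| <= #|J2| + k * D.
  have := cardsID B J1; have := subset_leq_card (subsetIr J1 B); move: bad; rewrite -/J2; card_lia.
have c2' : #|ctr @: J2| <= #|ctr @: J1| by apply/subset_leq_card/imsetS/subsetDl.
have [s sJ cS|A h2] := @bit_selection T ctr (foot e c) (attached e c) J2.
  move: sJ; rewrite in_setD => /andP [sB sJ]; apply: contra sB => E.
  by rewrite [s \in B]in_set sJ cS.
move: h2; rewrite /=; set JA := [set s in J2 | _] => h2.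
have [J4 J4A [h3 h4]] := restrict_fibres ctr JA.
have J4P s : s \in J4 -> s \in J1 /\ (foot e c s \in A /\
    (ctr s \in attached e c -> foot e c (ctr s) \notin A)).
  move/(subsetP J4A); rewrite [s \in JA]in_set => /and3P [/setDP [s1 _] s2 s3].
  by split=> //; split=> // cS; rewrite cS in s3.
(* With [q] the quotient of [#|J4|] by [M], the parts cost at most
   [6 * (k * (D * q)) + 6 * (k * D)]. The value 24 makes the first term at most a quarter of
   [#|J4|], thus at most half the surplus. *)
pose M := 24 * k * D.
have M0 : 0 < M by rewrite !muln_gt0 k0 (ltnW D2).
have DM : D <= M by rewrite leq_pmull // muln_gt0 k0.
have J41 : J4 \subset J1 by apply/subsetP => s /J4P [].
have few := few_legs e_sym e_irr girth c_short degD sys J41 (fun s sJ => (J4P s sJ).2) M0 DM ok.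
have gain : #|J4| <= #|ctr @: J4| + (12 * k + 192 * k * k) * D.
  move: few h4; have := leq_divM #|J4| M; move: (#|J4| %/ M) => q.
  have -> : q * M = 24 * (k * (D * q)) by rewrite /M; lia.
  have -> : 4 * k * M = 96 * (k * k * D) by rewrite /M; lia.
  have -> : (12 * k + 192 * k * k) * D = 12 * (k * D) + 192 * (k * k * D) by lia.
  have le : 3 * k * (D * (q + 1) + (q + 1).+1) <= 6 * (k * (D * q)) + 6 * (k * D).
    have -> : 6 * (k * (D * q)) + 6 * (k * D) = 3 * k * (2 * (D * q) + 2 * D) by lia.
    rewrite leq_mul2l; apply/orP; right.
    have := leq_mul (ltnW D2) (leqnn q); rewrite mulnDr muln1 mul1n; lia.
  move: le; move: (k * (D * q)) (k * D) (k * k * D) #|J4| #|ctr @: J4| (3 * k * _) => *; lia.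
have total := arcs_total e_sym e_irr girth c_short.
have edges := n_edges_le e_sym e_irr.
have comp := n_components_le1 e_sym conn.
have rE : (rank_const k).+1 * D = 96 * ((12 * k + 192 * k * k) * D) + 12 * (k * D) + D.
  by rewrite /rank_const; lia.
rewrite rE; move: ((12 * k + 192 * k * k) * D) (k * D) gain c2 => u v gain c2.
move: h0 h1 c2 c2' h2 h3 gain total edges comp D2; clear.
move: (n_edges e) (n_components e) #|ctr @: J4| #|ctr @: JA| #|ctr @: J2| #|ctr @: J1| #|ctr @: J|.
move: #|J4| #|JA| #|J2| #|J1| #|J| #|attached e c| #|rest e c| (arcs e (rest e c)) (arcs e setT) #|T| => *.
lia.
Qed.

Lemma cycle_degree2 (T : finType) (e : rel T) c : symmetric e -> is_cycle e c ->
  exists x, 2 <= deg e x.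
Proof.
move=> e_sym [c3 un cc]; case: c c3 un cc => [|x [|y [|z c]]] //= _.
rewrite !inE !negb_or => /andP [/and3P [_ xz _] _] /and3P [exy eyz _].
exists y; rewrite /deg; apply: leq_trans (_ : #|[set x; z]| <= _); first by rewrite cards2 xz.
by apply/subset_leq_card/subsetP => t /set2P [->|->]; rewrite inE // e_sym.
Qed.

Import Order.TTheory GRing.Theory Num.Theory.
Local Open Scope ring_scope.

Theorem mainTheorem15 (R : realType) (k : nat) : (1 <= k)%N ->
  exists delta : R, 0 < delta /\
    forall (T : finType) (e : rel T) (c : seq T),
      simple_graph e -> connected_graph e -> Ok_free e k ->
      girth_ge e 11 -> has_cycle e ->
      shortest_cycle e c ->
      induced_forest e (rest e c) ->
      exists x : T, delta * (cycle_rank e)%:~R <= (deg e x)%:R.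
Proof.
move=> k0; exists (((rank_const k).+1)%:R^-1); split; first by rewrite invr_gt0 ltr0n.
move=> T e c simple conn ok girth _ c_short forest.
have [e_sym _] := simple; have [cyc _] := c_short.
have [y y2] := cycle_degree2 e_sym cyc.
have T0 : (0 < #|T|)%N by apply/card_gt0P; exists y.
have [x Ex] := @bigop.eq_bigmax T (deg e) T0.
have degx z : (deg e z <= deg e x)%N by rewrite -Ex; apply: (@bigop.leq_bigmax T (deg e)).
have h := rank_le_max_degree k0 simple conn ok girth c_short forest (leq_trans y2 (degx y)) degx.
exists x; rewrite ler_pdivrMl ?ltr0n // -natrM -[leRHS]/(((_ * _)%N : int)%:~R) ler_int /cycle_rank.
by move: h; move: (rank_const k).+1 (deg e x) => B D; lia.
Qed.
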